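(* Let $\mathcal{N}$ and $\mathcal{N}'$ be nests on a complex Hilbert space $\mathbf{H}$, and let $\mathrm{Alg}(\mathcal{N})$ and $\mathrm{Alg}(\mathcal{N}')$ be the nest algebras associated with $\mathcal{N}$ and $\mathcal{N}'$, respectively. If $\mathfrak{l}\colon\mathrm{Alg}(\mathcal{N})\to\mathrm{Alg}(\mathcal{N}')$ is a Lie triple isomorphism, then $\mathfrak{l}=\pm\mathfrak{m}+\mathfrak{n}$ (that is, $\mathfrak{l}=\mathfrak{m}+\mathfrak{n}$ or $\mathfrak{l}=-\mathfrak{m}+\mathfrak{n}$), where $\mathfrak{m}\colon\mathrm{Alg}(\mathcal{N})\to\mathrm{Alg}(\mathcal{N}')$ is an isomorphism or an anti-isomorphism and $\mathfrak{n}\colon\mathrm{Alg}(\mathcal{N})\to\mathbb{C}1'$ is a linear mapping vanishing on each second commutator $[[x,y],z]$.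
   Context: A nest on $\mathbf{H}$ is a chain $\mathcal{N}$ of closed subspaces of $\mathbf{H}$ that contains $0$ and $\mathbf{H}$ and is closed under arbitrary intersections and closed linear spans; $\mathrm{Alg}(\mathcal{N})$ is the algebra of all bounded linear operators $T$ on $\mathbf{H}$ with $T(N)\subseteq N$ for all $N\in\mathcal{N}$. $1'$ is the identity of $\mathrm{Alg}(\mathcal{N}')$, and $[x,y]=xy-yx$. A Lie triple isomorphism is a $\mathbb{C}$-linear bijective mapping $\mathfrak{l}$ with $\mathfrak{l}([[a,b],c])=[[\mathfrak{l}(a),\mathfrak{l}(b)],\mathfrak{l}(c)]$ for all $a,b,c$. Isomorphisms and anti-isomorphisms are of $\mathbb{C}$-algebras (an anti-isomorphism is a linear bijection reversing products). *)

(* Defs.v *)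
From HB Require Import structures.
From mathcomp Require Import all_boot all_order all_algebra.
From mathcomp Require Import all_classical all_reals all_analysis.
From mathcomp Require Import complex sesquilinear.

Set Implicit Arguments.
Unset Strict Implicit.
Unset Printing Implicit Defensive.
Import Order.TTheory GRing.Theory Num.Theory.
Import numFieldNormedType.Exports.

Local Open Scope classical_set_scope.
Local Open Scope complex_scope.
Local Open Scope ring_scope.

(* The Hilbert norm is the norm of the underlying complete normed module, which
   must be the one induced by the inner product (linear in its first argument). *)
HB.mixin Record CompleteNormedModule_isHilbert (R : realType) H
    & CompleteNormedModule R[i] H := {
  inner : {dot H for Num.conj};
  inner_norm : forall x : H, `|x| ^+ 2 = inner x x;
}.

#[short(type="hilbertType")]
HB.structure Definition Hilbert (R : realType) :=
  {H of CompleteNormedModule R[i] H & CompleteNormedModule_isHilbert R H}.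

Definition lie (A : pzRingType) (x y : A) : A := x * y - y * x.

Section Nest.
Variables (R : realType) (H : hilbertType R).

Definition linear_subspace (A : set H) :=
  A 0 /\ forall (a : R[i]) (x y : H), A x -> A y -> A (a *: x + y).

Definition closed_span (A : set H) : set H :=
  closure (smallest linear_subspace A).

(* nest_bigcap and nest_span allow the empty family, for which they give H
   and 0 respectively. *)
Record nest := Nest {
  nest_set :> set (set H);
  nest_subspace : forall X, nest_set X -> linear_subspace X /\ closed X;
  nest_chain : forall X Y, nest_set X -> nest_set Y -> X `<=` Y \/ Y `<=` X;
  nest0 : nest_set [set 0];
  nestT : nest_set setT;
  nest_bigcap : forall F, F `<=` nest_set -> nest_set (\bigcap_(X in F) X);
  nest_span : forall F, F `<=` nest_set ->
    nest_set (closed_span (\bigcup_(X in F) X)) }.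

Definition bounded_operator (T : H -> H) :=
  linear T /\ exists M : R, forall x, `|T x| <= M%:C * `|x|.

Definition nest_operator (N : nest) : {pred (H -> H)} :=
  [pred T | `[< bounded_operator T /\
                forall X, nest_set N X -> T @` X `<=` X >]].

(* Alg(N) is equipped below with the pointwise R[i]-module structure and with
   composition as product. It is only a pzRingType, hence not an algType, because
   H = 0 is allowed; nest_alg_scaleAl and nest_alg_scaleAr complete the algebra
   axioms. *)
Section NestOperators.
Variable N : nest.

Let bounded_cst (T : H -> H) : bounded_operator T ->
  exists2 M : R, 0 <= M & forall x, `|T x| <= M%:C * `|x|.
Proof.
move=> [_ [M TM]]; exists `|M| => // x; apply: le_trans (TM x) _.
by rewrite ler_wpM2r// lecR ler_norm.
Qed.

Lemma nest_operator_submod : submod_closed (nest_operator N).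
Proof.
split=> [|a S T /asboolP[bS NS] /asboolP[bT NT]]; apply/asboolP.
  split; last by move=> X NX y [x _ <-]; have [[]] := nest_subspace NX.
  split=> [b x y|]; first by rewrite scaler0 addr0.
  by exists 0 => x; rewrite normr0 mul0r.
split; last first.
  move=> X NX y [x Xx <-]; have [[_ XD] _] := nest_subspace NX.
  by apply: XD; [apply: (NS _ NX); exists x|apply: (NT _ NX); exists x].
have [A A0 SA] := bounded_cst bS; have [B B0 TB] := bounded_cst bT.
split=> [b x y|].
  change (a *: S (b *: x + y) + T (b *: x + y) =
          b *: (a *: S x + T x) + (a *: S y + T y)).
  by rewrite bS.1 bT.1 !scalerDr !scalerA (mulrC a) addrACA.
exists (complex.Re `|a| * A + B) => x.
change (`|a *: S x + T x| <= (complex.Re `|a| * A + B)%:C * `|x|).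
have aE : `|a| = (complex.Re `|a|)%:C by case: a.
rewrite rmorphD rmorphM/= -aE mulrDl -mulrA (le_trans (ler_normD _ _))//.
by rewrite normrZ lerD// ler_wpM2l.
Qed.

Lemma nest_operator_id : (id : H -> H) \in nest_operator N.
Proof.
apply/asboolP; split=> [|X _ y [x Xx <-]//].
by split=> //; exists 1 => x; rewrite mul1r.
Qed.

Lemma nest_operator_comp (S T : H -> H) :
  S \in nest_operator N -> T \in nest_operator N -> S \o T \in nest_operator N.
Proof.
move=> /asboolP[bS NS] /asboolP[bT NT]; apply/asboolP; split.
  have [A A0 SA] := bounded_cst bS; have [B B0 TB] := bounded_cst bT.
  split=> [b x y|]; first by rewrite /= bT.1 bS.1.
  exists (A * B) => x; rewrite rmorphM/= -mulrA (le_trans (SA _))//.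
  by rewrite ler_wpM2l// lecR.
by move=> X NX y [x Xx <-]; apply: (NS _ NX); exists (T x) => //;
   apply: (NT _ NX); exists x.
Qed.

HB.instance Definition _ :=
  GRing.isSubmodClosed.Build R[i] (H -> H) (nest_operator N)
    nest_operator_submod.

Record nest_alg := NestAlg {
  nest_alg_fun :> H -> H;
  nest_algP : nest_alg_fun \in nest_operator N }.

HB.instance Definition _ := [isSub for nest_alg_fun].
HB.instance Definition _ := [Choice of nest_alg by <:].
HB.instance Definition _ := [SubChoice_isSubLmodule of nest_alg by <:].

Definition nest_alg1 : nest_alg := NestAlg nest_operator_id.

Definition nest_alg_mul (S T : nest_alg) : nest_alg :=
  NestAlg (nest_operator_comp (nest_algP S) (nest_algP T)).

Let mulA : associative nest_alg_mul. Proof. by move=> S T U; apply: val_inj. Qed.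
Let mul1 : left_id nest_alg1 nest_alg_mul. Proof. by move=> S; apply: val_inj. Qed.
Let mulr1 : right_id nest_alg1 nest_alg_mul. Proof. by move=> S; apply: val_inj. Qed.
Let mulDl : left_distributive nest_alg_mul +%R.
Proof. by move=> S T U; apply: val_inj. Qed.
Let mulDr : right_distributive nest_alg_mul +%R.
Proof.
move=> S T U; apply: val_inj; apply/funext => x /=.
have /asboolP[[Slin _] _] := nest_algP S.
change (S (T x + U x) = S (T x) + S (U x)).
by rewrite -[T x]scale1r Slin !scale1r.
Qed.

HB.instance Definition _ := GRing.Zmodule_isPzRing.Build nest_alg
  mulA mul1 mulr1 mulDl mulDr.

Lemma nest_alg_addE (S T : nest_alg) x : (S + T) x = S x + T x.
Proof. by []. Qed.

Lemma nest_alg_scaleE a (T : nest_alg) x : (a *: T) x = a *: T x.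
Proof. by []. Qed.

Lemma nest_alg_oneE x : (1 : nest_alg) x = x.
Proof. by []. Qed.

Lemma nest_alg_mulE (S T : nest_alg) x : (S * T) x = S (T x).
Proof. by []. Qed.

Lemma nest_alg_scaleAl a (S T : nest_alg) : a *: (S * T) = (a *: S) * T.
Proof. by apply: val_inj. Qed.

Lemma nest_alg_scaleAr a (S T : nest_alg) : a *: (S * T) = S * (a *: T).
Proof.
apply: val_inj; apply/funext => x /=.
have /asboolP[[Slin _] _] := nest_algP S.
change (a *: S (T x) = S (a *: T x)).
have S0 : S 0 = 0 by rewrite -{1}(subrr (0 : H)) addrC -scaleN1r Slin scaleN1r addNr.
by rewrite -[a *: T x]addr0 Slin S0 addr0.
Qed.

End NestOperators.

End Nest.

Section Maps.
Variables (R : realType) (H : hilbertType R) (N N' : nest H).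
Implicit Types f : nest_alg N -> nest_alg N'.

Definition alg_isomorphism f :=
  [/\ linear f, bijective f & forall x y, f (x * y) = f x * f y].

Definition alg_antiisomorphism f :=
  [/\ linear f, bijective f & forall x y, f (x * y) = f y * f x].

Definition lie_triple_isomorphism f :=
  [/\ linear f, bijective f &
    forall a b c, f (lie (lie a b) c) = lie (lie (f a) (f b)) (f c)].

End Maps.

(* Main.v *)
(* Let P be an idempotent of A' = Alg(N') other than 0 and 1: the projection onto
   a nontrivial member of N', or a rank-one projection if N' is trivial. Since
   ad(P)^3 = ad(P), the operator a = l^-1(P) satisfies ad(a)^3 = ad(a) on
   A = Alg(N), and this forces a = E + c or a = -E + c with E idempotent and c a
   scalar. If N' is nontrivial, this is because the eigenspaces of ad(a) for 1 and
   -1 are ideals of A which multiply to zero, whereas nonzero ideals of a nest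
   algebra meet, so ad(a)^2 = ad(a) or ad(a)^2 = -ad(a). If both nests are trivial,
   rank-one operators show that a is quadratic.
     Put F = 1 - E and Q = 1 - P. Up to a sign and to passing to the opposite
   algebra, l maps EAF to PA'Q and FAE to QA'P. For d in EAE, comparing the images
   of [d, [d, x]] = [d^2, x] for x in EAF shows that, modulo scalars, l(d) acts on
   PA'Q from one side only. Hence l maps EAE into PA'P + C and FAF into QA'Q + C, or
   crosswise, and the actions on EAF and PA'Q show that removing the scalar parts
   leaves an isomorphism, respectively the opposite of an anti-isomorphism. *)

Require Import Defs.
From mathcomp Require Import all_boot all_order all_algebra.
From mathcomp Require Import all_classical all_reals all_analysis.
From mathcomp Require Import complex sesquilinear lra.

Set Implicit Arguments.
Unset Strict Implicit.
Unset Printing Implicit Defensive.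
Import Order.TTheory GRing.Theory Num.Theory.
Import numFieldNormedType.Exports.

Local Open Scope ring_scope.

(** * Identities in noncommutative rings *)

(** A Lie triple map controls only second commutators, so a single commutator [x, y] is known at
    first only up to the centre. Off-diagonal corners remove this ambiguity: for d commuting with E
    and x in EAF, [d, x] = -[[d, x], E] is itself a second commutator, and a scalar lying in PA'Q or
    in PA'P is zero. The corner argument uses operator theory only through two facts about the
    action of the diagonal corners on EAF, which rank-one operators provide; everything else there
    is ring theory. A trivial and a nontrivial nest are told apart by primeness: on B(H) no nonzero
    x satisfies x y x = 0 for all y, whereas every x with [a, x] = x does so once ad(a)^2 = ad(a).
    If dim H <= 1 there is no P to start from, but then every operator is a scalar. *)

Inductive nc_expr : Type :=
| NcVar of nat | NcZero | NcOne
| NcAdd of nc_expr & nc_expr | NcOpp of nc_expr | NcMul of nc_expr & nc_expr.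

Section NcRing.
Variables (A : pzRingType) (env : seq A).

Fixpoint nc_eval (e : nc_expr) : A :=
  match e with
  | NcVar i => env`_i
  | NcZero => 0
  | NcOne => 1
  | NcAdd e1 e2 => nc_eval e1 + nc_eval e2
  | NcOpp e1 => - nc_eval e1
  | NcMul e1 e2 => nc_eval e1 * nc_eval e2
  end.

(* A signed sum of words in the variables; [true] is the sign -1. *)
Fixpoint nc_norm (e : nc_expr) : seq (bool * seq nat) :=
  match e with
  | NcVar i => [:: (false, [:: i])]
  | NcZero => [::]
  | NcOne => [:: (false, [::])]
  | NcAdd e1 e2 => nc_norm e1 ++ nc_norm e2
  | NcOpp e1 => [seq (~~ t.1, t.2) | t <- nc_norm e1]
  | NcMul e1 e2 =>
      [seq (t1.1 (+) t2.1, t1.2 ++ t2.2) | t1 <- nc_norm e1, t2 <- nc_norm e2]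
  end.

Definition nc_monom (t : bool * seq nat) : A :=
  (-1) ^+ t.1 * \prod_(i <- t.2) env`_i.

Lemma nc_normE e : nc_eval e = \sum_(t <- nc_norm e) nc_monom t.
Proof.
elim: e => [i|||e1 IH1 e2 IH2|e IH|e1 IH1 e2 IH2] /=.
- by rewrite big_seq1 /nc_monom /= expr0 mul1r big_seq1.
- by rewrite big_nil.
- by rewrite big_seq1 /nc_monom /= big_nil mulr1 expr0.
- by rewrite big_cat IH1 IH2.
- rewrite big_map IH -sumrN; apply: eq_bigr => -[b w] _.
  by rewrite /nc_monom /= signrN mulNr.
- rewrite big_allpairs_dep IH1 IH2 mulr_suml; apply: eq_bigr => -[b1 w1] _.
  rewrite mulr_sumr; apply: eq_bigr => -[b2 w2] _.
  rewrite /nc_monom /= signr_addb big_cat /= -!mulrA; congr (_ * _).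
  rewrite !mulrA; congr (_ * _).
  by case: b2; rewrite ?expr0 ?mulr1 ?mul1r// expr1 mulrN1 mulN1r.
Qed.

(** The bound [n] makes the recursion structural, which [rem] alone would not; each round removes
    two words, so the length of the list is enough fuel. *)
Fixpoint nc_cancel (n : nat) (s : seq (bool * seq nat)) : bool :=
  match n, s with
  | _, [::] => true
  | n.+1, (b, w) :: s' =>
      ((~~ b, w) \in s') && nc_cancel n (rem (~~ b, w) s')
  | _, _ => false
  end.

Lemma nc_cancelP n s : nc_cancel n s -> \sum_(t <- s) nc_monom t = 0.
Proof.
elim: n s => [|n IH] [|[b w] s] //=; rewrite ?big_nil// => /andP[ws /IH s0].
rewrite big_cons (perm_big _ (perm_to_rem ws)) /= big_cons s0 addr0.
by rewrite /nc_monom /= signrN mulNr subrr.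
Qed.

Lemma nc_ring_correct e1 e2 :
  (let s := nc_norm (NcAdd e1 (NcOpp e2)) in nc_cancel (size s) s) ->
  nc_eval e1 = nc_eval e2.
Proof.
by move=> /nc_cancelP; rewrite -nc_normE/= => /eqP; rewrite subr_eq0 => /eqP.
Qed.

End NcRing.

Ltac nc_mem x l :=
  lazymatch l with
  | nil => constr:(false)
  | cons x _ => constr:(true)
  | cons _ ?l' => nc_mem x l'
  end.

Ltac nc_atoms t l :=
  lazymatch t with
  | GRing.add ?a ?b => let l1 := nc_atoms a l in nc_atoms b l1
  | GRing.mul ?a ?b => let l1 := nc_atoms a l in nc_atoms b l1
  | GRing.opp ?a => nc_atoms a l
  | @GRing.zero _ => l
  | @GRing.one _ => l
  | _ => match nc_mem t l with true => l | false => constr:(cons t l) end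
  end.

Ltac nc_index t l :=
  lazymatch l with
  | cons t _ => constr:(O)
  | cons _ ?l' => let n := nc_index t l' in constr:(S n)
  end.

Ltac nc_reify t l :=
  lazymatch t with
  | GRing.add ?a ?b =>
      let x := nc_reify a l in let y := nc_reify b l in constr:(NcAdd x y)
  | GRing.mul ?a ?b =>
      let x := nc_reify a l in let y := nc_reify b l in constr:(NcMul x y)
  | GRing.opp ?a => let x := nc_reify a l in constr:(NcOpp x)
  | @GRing.zero _ => constr:(NcZero)
  | @GRing.one _ => constr:(NcOne)
  | _ => let n := nc_index t l in constr:(NcVar n)
  end.

Ltac nc_ring :=
  lazymatch goal with
  | |- @eq ?A ?x ?y =>
      let l1 := nc_atoms x (@nil A) in
      let l := nc_atoms y l1 in
      let ex := nc_reify x l in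
      let ey := nc_reify y l in
      exact: (@nc_ring_correct _ l ex ey isT)
  end.

(** * Peirce decompositions and Lie triple isomorphisms *)

(** Membership in the Peirce corner EAF for idempotents E and F, as fixed-point equations so that no
    preimage has to be carried along. *)
Definition corner (A : pzRingType) (E F x : A) := E * x = x /\ x * F = x.

(* A K-algebra is encoded as a ring with a central copy of K, because nest
   algebras are only pzRingTypes. *)
Record scalars (K : numFieldType) (A : pzRingType) (iota : K -> A) : Prop := {
  scalarD : {morph iota : x y / x + y};
  scalarM : {morph iota : x y / x * y};
  scalar1 : iota 1 = 1;
  scalarC : forall k x, iota k * x = x * iota k }.

(* With F = 1 - E, the last two fields say that EAE and FAF act on EAF
   independently of each other up to scalars; they hold as soon as EAF contains
   the rank-one operators with range in EH and kernel containing EH. *)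
Record peirce (K : numFieldType) (A : pzRingType) (iota : K -> A) (E F : A) :
    Prop := {
  peirce_scalars : scalars iota;
  peirce_idem : E * E = E;
  peirce_sum : E + F = 1;
  peirce_neq0l : E <> 0;
  peirce_neq0r : F <> 0;
  peirce_tensor : forall a b c d,
    corner E E a -> corner F F b -> corner E E c -> corner F F d ->
    (forall x, corner E F x -> a * x * b = c * x + x * d) ->
    (exists k, a = iota k * E) \/ (exists k, b = iota k * F);
  peirce_balanced : forall c d, corner E E c -> corner F F d ->
    (forall x, corner E F x -> c * x = x * d) ->
    exists k, c = iota k * E /\ d = iota k * F }.

Section Scalars.
Variables (K : numFieldType) (A : pzRingType) (iota : K -> A).
Hypothesis iotaP : scalars iota.

Lemma scalar0 : iota 0 = 0.
Proof. by apply: (addrI (iota 0)); rewrite -scalarD// !addr0. Qed.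

Lemma scalarN k : iota (- k) = - iota k.
Proof. by apply: (addrI (iota k)); rewrite -scalarD// !subrr scalar0. Qed.

Lemma scalarMV k : k != 0 -> iota k^-1 * iota k = 1.
Proof. by move=> k0; rewrite -scalarM// mulVf// scalar1. Qed.

Lemma scalarI k x : k != 0 -> iota k * x = 0 -> x = 0.
Proof.
by move=> k0 kx; rewrite -[x]mul1r -(scalarMV k0) -mulrA kx mulr0.
Qed.

Lemma scalar_half : iota 2^-1 + iota 2^-1 = 1.
Proof.
by rewrite -scalarD// -mulr2n -[_ *+ 2]mulr_natr mulVf ?pnatr_eq0// scalar1.
Qed.

Lemma doubler_eq0 (x : A) : x + x = 0 -> x = 0.
Proof.
move=> xx; rewrite -[x]mul1r -scalar_half.
by rewrite mulrDl -mulrDr xx mulr0.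
Qed.

End Scalars.

Section Peirce.
Variables (K : numFieldType) (A : pzRingType) (iota : K -> A) (E F : A).
Hypothesis EFP : peirce iota E F.
Let iotaP := peirce_scalars EFP.

Lemma peirceF : F = 1 - E.
Proof. by rewrite -(peirce_sum EFP) addrAC subrr add0r. Qed.

Lemma peirceEF : E * F = 0.
Proof. by rewrite peirceF mulrBr mulr1 (peirce_idem EFP) subrr. Qed.

Lemma peirceFE : F * E = 0.
Proof. by rewrite peirceF mulrBl mul1r (peirce_idem EFP) subrr. Qed.

Lemma peirceFF : F * F = F.
Proof. by rewrite {1}peirceF mulrBl mul1r peirceEF subr0. Qed.

Let EE := peirce_idem EFP.

Lemma cornerEE x : corner E E (E * x * E).
Proof. by split; rewrite ?mulrA ?EE// -!mulrA EE. Qed.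
Lemma cornerEF x : corner E F (E * x * F).
Proof. by split; rewrite ?mulrA ?EE// -!mulrA peirceFF. Qed.
Lemma cornerFE x : corner F E (F * x * E).
Proof. by split; rewrite ?mulrA ?peirceFF// -!mulrA EE. Qed.
Lemma cornerFF x : corner F F (F * x * F).
Proof. by split; rewrite ?mulrA ?peirceFF// -!mulrA peirceFF. Qed.

Lemma peirce_decomp x :
  x = E * x * E + E * x * F + (F * x * E + F * x * F).
Proof. by rewrite -!mulrDr (peirce_sum EFP) !mulr1 -mulrDl (peirce_sum EFP) mul1r. Qed.

Lemma corner_mul0 X Y x y : corner X E x -> corner F Y y -> x * y = 0.
Proof. by move=> [_ <-] [<- _]; rewrite mulrA -(mulrA x) peirceEF mulr0 mul0r. Qed.

Lemma corner_mul0' X Y x y : corner X F x -> corner E Y y -> x * y = 0.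
Proof. by move=> [_ <-] [<- _]; rewrite mulrA -(mulrA x) peirceFE mulr0 mul0r. Qed.

Lemma scalar_inj k : iota k = 0 -> k = 0.
Proof.
move=> k0; apply/eqP/negPn/negP => /(scalarI iotaP) kI.
by apply: (peirce_neq0l EFP); apply: kI; rewrite k0 mul0r.
Qed.

(** Balancing [c] against the zero action on the right gives a scalar k with kF = 0, and k = 0
    because F is nonzero. *)
Lemma faithfull c : corner E E c -> (forall x, corner E F x -> c * x = 0) -> c = 0.
Proof.
move=> cE c0; have [|x /c0 ->|k [-> k0]] := peirce_balanced EFP cE (d := 0).
- by split; rewrite (mulr0, mul0r).
- by rewrite mulr0.
have [->|kn0] := eqVneq k 0; first by rewrite (scalar0 iotaP) mul0r.
by case: (peirce_neq0r EFP); exact: (scalarI iotaP kn0).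
Qed.

Lemma faithfulr d : corner F F d -> (forall x, corner E F x -> x * d = 0) -> d = 0.
Proof.
move=> dF d0; have [|x /d0 ->|k [k0 ->]] := peirce_balanced EFP (c := 0) _ dF.
- by split; rewrite (mulr0, mul0r).
- by rewrite mul0r.
have [->|kn0] := eqVneq k 0; first by rewrite (scalar0 iotaP) mul0r.
by case: (peirce_neq0l EFP); exact: (scalarI iotaP kn0).
Qed.

Lemma commE x : E * x = x * E -> E * x * F = 0 /\ F * x * E = 0.
Proof.
by move=> Ex; rewrite {1}Ex -mulrA peirceEF mulr0 -mulrA -Ex mulrA peirceFE mul0r.
Qed.


(** The two diagonal parts of a central element act on EAF by the same map, from the left and from
    the right, so they are one scalar. *)
Lemma centre_scalar z : (forall x, z * x = x * z) -> exists k, z = iota k.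
Proof.
move=> zC; have [x [Ex xF]|k [zE zF]] := peirce_balanced EFP (cornerEE z) (cornerFF z).
  rewrite -(mulrA _ E) Ex -mulrA (zC x) mulrA Ex.
  by rewrite !mulrA xF -(zC x) -mulrA xF zC.
exists k; rewrite (peirce_decomp z) zE zF -(zC F) -(zC E) -!mulrA.
rewrite peirceEF peirceFE !mulr0 addr0 add0r -mulrDr (peirce_sum EFP).
by rewrite mulr1.
Qed.

End Peirce.

(** The inverse is kept as data, so that swapping [l] and [l'] gives the same structure and each
    statement can be applied in both directions. *)
Record lie_triple_equiv (K : numFieldType) (A A' : pzRingType)
    (iota : K -> A) (iota' : K -> A') (l : A -> A') (l' : A' -> A) : Prop := {
  ltriple_lin : forall k x y, l (iota k * x + y) = iota' k * l x + l y;
  ltripleK : cancel l l';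
  ltripleVK : cancel l' l;
  ltriple_lie : forall x y z, l (lie (lie x y) z) = lie (lie (l x) (l y)) (l z) }.

Section LieIdentities.
Variable A : pzRingType.
Implicit Types x y z : A.

Lemma lieD x y z : lie x (y + z) = lie x y + lie x z.
Proof. rewrite /lie; nc_ring. Qed.
Lemma lieDl x y z : lie (x + y) z = lie x z + lie y z.
Proof. rewrite /lie; nc_ring. Qed.
Lemma lieN x y : lie x (- y) = - lie x y.
Proof. rewrite /lie; nc_ring. Qed.
Lemma lie0 x : lie x 0 = 0.
Proof. rewrite /lie; nc_ring. Qed.
Lemma lie0l x : lie 0 x = 0.
Proof. rewrite /lie; nc_ring. Qed.
Lemma lieC x y : lie x y = - lie y x.
Proof. rewrite /lie; nc_ring. Qed.
Lemma lie_eq0 x y : lie x y = 0 <-> x * y = y * x.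
Proof. by rewrite /lie; split=> [/eqP|->]; rewrite (subrr, subr_eq0)// => /eqP. Qed.

Lemma lie_idem3 e x : e * e = e -> lie e (lie e (lie e x)) = lie e x.
Proof.
move=> ee; have xee (y : A) : y * e * e = y * e by rewrite -mulrA ee.
rewrite /lie !(mulrBl, mulrBr) !mulrA !(xee, ee); nc_ring.
Qed.

End LieIdentities.

Section Scalars2.
Variables (K : numFieldType) (A : pzRingType) (iota : K -> A).
Hypothesis iotaP : scalars iota.

Lemma lie_scalar k x : lie (iota k) x = 0.
Proof. by apply/lie_eq0; exact: scalarC. Qed.
Lemma lie_scalar_r k x : lie x (iota k) = 0.
Proof. by apply/lie_eq0; rewrite scalarC. Qed.

End Scalars2.

(* If [z, y] = c is a nonzero scalar, then [z, y^2] = 2cy is a scalar as well,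
   so y is a scalar and [z, y] = 0. *)
Lemma second_centre (K : numFieldType) (A : pzRingType) (iota : K -> A) (E F z : A) :
  peirce iota E F -> (forall x w, lie (lie z x) w = 0) -> exists k, z = iota k.
Proof.
move=> EFP zZ; have iotaP := peirce_scalars EFP.
have zS x : exists k, lie z x = iota k.
  by apply: (centre_scalar EFP) => w; apply/lie_eq0.
apply: (centre_scalar EFP) => y; apply/lie_eq0.
have [c zy] := zS y; have [c' zyy] := zS (y * y).
have [c0|cn0] := eqVneq c 0; first by rewrite zy c0 scalar0.
suff -> : y = iota (c^-1 * (2^-1 * c')) by rewrite lie_scalar_r.
have : iota c * y + iota c * y = iota c'.
  by rewrite -zyy -zy {2}zy (scalarC iotaP) -zy /lie; nc_ring.
move=> ycc; have cy : iota c * y = iota (2^-1 * c').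
  rewrite scalarM// -ycc mulrDr -mulrDl; rewrite -{1}[iota c * y]mul1r.
  by rewrite -(scalar_half iotaP).
by rewrite scalarM// -cy mulrA scalarMV// mul1r.
Qed.

Section LieTripleEquiv.
Variables (K : numFieldType) (A A' : pzRingType) (iota : K -> A) (iota' : K -> A').
Variables (l : A -> A') (l' : A' -> A).
Hypothesis iotaP : scalars iota.
Hypothesis iotaP' : scalars iota'.
Hypothesis lP : lie_triple_equiv iota iota' l l'.

Lemma ltripleD : {morph l : x y / x + y}.
Proof.
by move=> x y; have := ltriple_lin lP 1 x y; rewrite !scalar1// !mul1r.
Qed.

Lemma ltriple0 : l 0 = 0.
Proof. by apply: (addrI (l 0)); rewrite -ltripleD !addr0. Qed.

Lemma ltripleZ k x : l (iota k * x) = iota' k * l x.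
Proof. by have := ltriple_lin lP k x 0; rewrite ltriple0 !addr0. Qed.

Lemma ltripleN : {morph l : x / - x}.
Proof. by move=> x; apply: (addrI (l x)); rewrite -ltripleD !subrr ltriple0. Qed.

Lemma ltripleB : {morph l : x y / x - y}.
Proof. by move=> x y; rewrite ltripleD ltripleN. Qed.

Lemma ltripleI : injective l. Proof. exact: can_inj (ltripleK lP). Qed.

Lemma ltripleV_lin k x y : l' (iota' k * x + y) = iota k * l' x + l' y.
Proof. by apply: ltripleI; rewrite (ltriple_lin lP) !(ltripleVK lP). Qed.

Lemma ltriple_inv : lie_triple_equiv iota' iota l' l.
Proof.
split=> [||| x y z]; [exact: ltripleV_lin | exact: (ltripleVK lP)|exact: (ltripleK lP)|].
by apply: ltripleI; rewrite (ltriple_lie lP) !(ltripleVK lP).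
Qed.

(** Scalars are characterised by [[z, x], w] = 0 for all x and w, a condition that [l]
    transports. *)
Lemma ltriple_scalar (P Q : A') k : peirce iota' P Q -> exists k', l (iota k) = iota' k'.
Proof.
move=> PQP; apply: (second_centre PQP) => x w.
rewrite -[x](ltripleVK lP) -[w](ltripleVK lP) -(ltriple_lie lP) lie_scalar// lie0l.
exact: ltriple0.
Qed.

End LieTripleEquiv.

Section Corners.
Variables (K : numFieldType) (A : pzRingType) (iota : K -> A) (E F : A).
Hypothesis EFP : peirce iota E F.

Lemma lie_cornerEF x : corner E F x -> lie x E = - x.
Proof.
by move=> [Ex xF]; rewrite /lie Ex -xF -mulrA (peirceFE EFP) mulr0 sub0r.
Qed.

Lemma lie_cornerFE x : corner F E x -> lie x E = x.
Proof.
by move=> [Fx xE]; rewrite /lie xE -Fx mulrA (peirceEF EFP) mul0r subr0.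
Qed.

(** The square of ad(E) is the projection onto the off-diagonal part EAF + FAE. *)
Lemma lie_idem2_corner x :
  lie (lie x E) E = x -> x = E * x * F + F * x * E.
Proof.
move=> xEE; have ee := peirce_idem EFP.
have xe (y : A) : y * E * E = y * E by rewrite -mulrA ee.
suff [ExE FxF] : E * x * E = 0 /\ F * x * F = 0.
  by rewrite {1}(peirce_decomp EFP x) ExE FxF addr0 add0r.
rewrite (peirceF EFP) -{}xEE /lie !(mulrBl, mulrBr, mulr1, mul1r) !mulrA.
by rewrite !(xe, ee); split; nc_ring.
Qed.

Lemma corner_disjoint x : corner E F x -> corner F E x -> x = 0.
Proof. by move=> [Ex _] [Fx _]; rewrite -Ex -Fx mulrA (peirceEF EFP) mul0r. Qed.

Lemma corner_sub (G H x y : A) :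
  corner G H x -> corner G H y -> corner G H (x - y).
Proof.
by move=> [Gx xH] [Gy yH]; split; rewrite (mulrBr, mulrBl) ?Gx ?Gy ?xH ?yH.
Qed.

Lemma corner_add (G H x y : A) :
  corner G H x -> corner G H y -> corner G H (x + y).
Proof.
by move=> [Gx xH] [Gy yH]; split; rewrite (mulrDr, mulrDl) ?Gx ?Gy ?xH ?yH.
Qed.

End Corners.

(** * Lie triple isomorphisms that respect the off-diagonal Peirce corners *)

Record peirce_lie (K : numFieldType) (A A' : pzRingType)
    (iota : K -> A) (iota' : K -> A') (E F : A) (P Q : A')
    (l : A -> A') (l' : A' -> A) : Prop := {
  pl_lte : lie_triple_equiv iota iota' l l';
  pl_src : peirce iota E F;
  pl_tgt : peirce iota' P Q;
  pl_idem : exists k, l E = P + iota' k;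
  pl_EF : forall x, corner E F x -> corner P Q (l x);
  pl_FE : forall x, corner F E x -> corner Q P (l x) }.

Section PeirceLie.
Variables (K : numFieldType) (A A' : pzRingType).
Variables (iota : K -> A) (iota' : K -> A') (E F : A) (P Q : A').
Variables (l : A -> A') (l' : A' -> A).
Hypothesis plP : peirce_lie iota iota' E F P Q l l'.
Let lP := pl_lte plP.
Let EFP := pl_src plP.
Let PQP := pl_tgt plP.
Let iotaP := peirce_scalars EFP.
Let iotaP' := peirce_scalars PQP.

Lemma pl_lie_idem x : lie (l E) x = lie P x.
Proof.
by have [k ->] := pl_idem plP; rewrite lieDl lie_scalar// addr0.
Qed.

Lemma lie_pl_idem x : lie x (l E) = lie x P.
Proof. by rewrite lieC pl_lie_idem -lieC. Qed.

(** [E, d] = 0 only makes [P, l d] central; then ad(P)^3 = ad(P) turns [P, l d] into an iterated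
    commutator of a central element, which is 0. *)
Lemma pl_comm d : E * d = d * E -> P * l d = l d * P.
Proof.
move=> /lie_eq0 Ed; apply/lie_eq0; rewrite -(lie_idem3 _ (peirce_idem PQP)).
have PdC w : lie (lie P (l d)) w = 0.
  rewrite -pl_lie_idem -[w](ltripleVK lP) -(ltriple_lie lP) Ed lie0l.
  exact: ltriple0 iotaP iotaP' lP.
by rewrite [lie P (lie P (l d))]lieC PdC oppr0 lie0.
Qed.

End PeirceLie.

Section PeirceLieInv.
Variables (K : numFieldType) (A A' : pzRingType).
Variables (iota : K -> A) (iota' : K -> A') (E F : A) (P Q : A').
Variables (l : A -> A') (l' : A' -> A).
Hypothesis plP : peirce_lie iota iota' E F P Q l l'.
Let lP := pl_lte plP.
Let EFP := pl_src plP.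
Let PQP := pl_tgt plP.
Let iotaP := peirce_scalars EFP.
Let iotaP' := peirce_scalars PQP.

Lemma pl_idemV : exists k, l' P = E + iota k.
Proof.
have [k lE] := pl_idem plP.
have [k' l'k] := ltriple_scalar iotaP' iotaP (ltriple_inv lP) k EFP.
exists (- k'); rewrite scalarN// -l'k; apply: (ltripleI lP).
rewrite (ltripleB iotaP iotaP' lP) !(ltripleVK lP) lE; nc_ring.
Qed.

Lemma pl_lie2V x : lie (lie x P) P = x -> lie (lie (l' x) E) E = l' x.
Proof.
move=> xPP; apply: (ltripleI lP).
rewrite (ltriple_lie lP) (ltripleVK lP) !(lie_pl_idem plP).
by rewrite xPP.
Qed.

(** The preimage is off-diagonal, and its unwanted FAE part has an image lying both in QA'P and, as
    a difference, in PA'Q; these corners meet in 0. *)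
Lemma pl_EFV x : corner P Q x -> corner E F (l' x).
Proof.
move=> xPQ; have xPP : lie (lie x P) P = x.
  by rewrite (lie_cornerEF PQP xPQ) lieC lieN -lieC (lie_cornerEF PQP xPQ) opprK.
have := lie_idem2_corner EFP (pl_lie2V xPP).
set y := l' x; move=> yE.
have lyE : l (F * y * E) = x - l (E * y * F).
  by rewrite -(ltripleVK lP x) -/y {2}yE (ltripleD iotaP iotaP' lP) addrAC subrr add0r.
have FyE : F * y * E = 0.
  apply: (ltripleI lP); rewrite (ltriple0 iotaP iotaP' lP).
  apply: (corner_disjoint PQP); last exact: (pl_FE plP (cornerFE EFP _)).
  by rewrite lyE; apply: corner_sub => //; exact: (pl_EF plP (cornerEF EFP _)).
by rewrite yE FyE addr0; exact: (cornerEF EFP).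
Qed.

Lemma pl_FEV x : corner Q P x -> corner F E (l' x).
Proof.
move=> xQP; have xPP : lie (lie x P) P = x by rewrite !(lie_cornerFE PQP xQP).
have := lie_idem2_corner EFP (pl_lie2V xPP).
set y := l' x; move=> yE.
have lyE : l (E * y * F) = x - l (F * y * E).
  by rewrite -(ltripleVK lP x) -/y {2}yE (ltripleD iotaP iotaP' lP) addrK.
have FyE : E * y * F = 0.
  apply: (ltripleI lP); rewrite (ltriple0 iotaP iotaP' lP).
  apply: (corner_disjoint PQP); first exact: (pl_EF plP (cornerEF EFP _)).
  by rewrite lyE; apply: corner_sub => //; exact: (pl_FE plP (cornerFE EFP _)).
by rewrite yE FyE add0r; exact: (cornerFE EFP).
Qed.

Lemma pl_inv : peirce_lie iota' iota P Q E F l' l.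
Proof.
split; [exact: ltriple_inv lP|exact: PQP|exact: EFP|exact: pl_idemV| |].
  exact: pl_EFV.
exact: pl_FEV.
Qed.

End PeirceLieInv.

Section PeirceLieTheory.
Variables (K : numFieldType) (A A' : pzRingType).
Variables (iota : K -> A) (iota' : K -> A') (E F : A) (P Q : A').
Variables (l : A -> A') (l' : A' -> A).
Hypothesis plP : peirce_lie iota iota' E F P Q l l'.
Let lP := pl_lte plP.
Let EFP := pl_src plP.
Let PQP := pl_tgt plP.
Let iotaP := peirce_scalars EFP.
Let iotaP' := peirce_scalars PQP.
Let lN := ltripleN iotaP iotaP' lP.

Lemma comm_peirceF (B : pzRingType) (kappa : K -> B) (G H d : B) :
  peirce kappa G H -> G * d = d * G -> H * d = d * H.
Proof. by move=> GHP Gd; rewrite (peirceF GHP) mulrBl mulrBr mul1r mulr1 Gd. Qed.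

Lemma corner_lieEF (B : pzRingType) (kappa : K -> B) (G H d x : B) :
  peirce kappa G H -> G * d = d * G -> corner G H x -> corner G H (lie d x).
Proof.
move=> GHP Gd [Gx xH]; have Hd := comm_peirceF GHP Gd.
rewrite /lie; split; first by rewrite mulrBr !mulrA Gd Gx -mulrA Gx.
by rewrite mulrBl -!mulrA xH -Hd mulrA xH.
Qed.

Lemma corner_lieFE (B : pzRingType) (kappa : K -> B) (G H d x : B) :
  peirce kappa G H -> G * d = d * G -> corner H G x -> corner H G (lie d x).
Proof.
move=> GHP Gd [Hx xG]; have Hd := comm_peirceF GHP Gd.
rewrite /lie; split; first by rewrite mulrBr !mulrA Hd Hx -mulrA Hx.
by rewrite mulrBl -!mulrA xG -Gd mulrA xG.
Qed.

(** Single commutators become available here: [d, x] lies in EAF, hence equals -[[d, x], E], and the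
    scalar by which l(E) differs from P drops out. *)
Lemma pl_lieEF d x : E * d = d * E -> corner E F x -> l (lie d x) = lie (l d) (l x).
Proof.
move=> Ed xEF; apply: oppr_inj; have Pd := pl_comm plP Ed.
rewrite -(lie_cornerEF PQP (corner_lieEF PQP Pd (pl_EF plP xEF))).
rewrite -(lie_pl_idem plP) -(ltriple_lie lP) -lN.
by rewrite (lie_cornerEF EFP (corner_lieEF EFP Ed xEF)).
Qed.

Lemma pl_lieFE d x : E * d = d * E -> corner F E x -> l (lie d x) = lie (l d) (l x).
Proof.
move=> Ed xFE; have Pd := pl_comm plP Ed.
rewrite -(lie_cornerFE PQP (corner_lieFE PQP Pd (pl_FE plP xFE))).
rewrite -(lie_pl_idem plP) -(ltriple_lie lP).
by rewrite (lie_cornerFE EFP (corner_lieFE EFP Ed xFE)).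
Qed.

Lemma cornerEE_comm (B : pzRingType) (G d : B) : corner G G d -> G * d = d * G.
Proof. by move=> [-> ->]. Qed.

Lemma cornerFF_comm (B : pzRingType) (kappa : K -> B) (G H d : B) :
  peirce kappa G H -> corner H H d -> G * d = d * G.
Proof.
by move=> GHP [Hd dH]; rewrite -{1}Hd -{2}dH mulrA (peirceEF GHP) mul0r -mulrA
  (peirceFE GHP) mulr0.
Qed.

Lemma corner_scale (B : pzRingType) (kappa : K -> B) (G H x : B) k :
  scalars kappa -> corner G H x -> corner G H (kappa k * x).
Proof.
move=> kC [Gx xH]; split; last by rewrite -mulrA xH.
by rewrite mulrA -scalarC// -mulrA Gx.
Qed.

(* For x in EAF and l(d) = a + b with a in PA'P and b in QA'Q, applying l to
   [d, [d, x]] = [d^2, x] writes a l(x) b as c l(x) + l(x) c'. *)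
Lemma pl_dichotomy d : corner E E d ->
  (exists k, corner P P (l d - iota' k)) \/ (exists k, corner Q Q (l d - iota' k)).
Proof.
move=> dE; have Ed := cornerEE_comm dE; have Pd := pl_comm plP Ed.
have Edd : E * (d * d) = d * d * E by rewrite mulrA Ed -!mulrA Ed.
have Pdd := pl_comm plP Edd.
have ldE : l d = P * l d * P + Q * l d * Q.
  have [PdQ QdP] := commE PQP Pd.
  by rewrite {1}(peirce_decomp PQP (l d)) PdQ QdP addr0 add0r.
have PP := peirce_idem PQP; have QQ := peirceFF PQP.
have Qd := comm_peirceF PQP Pd; have Qdd := comm_peirceF PQP Pdd.
(* Expanding the image of [d, [d, x]] = [d^2, x] with y = l(x) gives 2 l(d) y l(d) = (l(d)^2 -
   l(d^2)) y + y (l(d)^2 + l(d^2)), whence the half and the two signs below. *)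
set h := iota' 2^-1.
have := peirce_tensor PQP (a := P * l d * P) (b := Q * l d * Q)
  (c := h * (P * (l d * l d - l (d * d)) * P))
  (d := h * (Q * (l d * l d + l (d * d)) * Q)).
case.
- exact: cornerEE PQP _.
- exact: cornerFF PQP _.
- exact/corner_scale/(cornerEE PQP).
- exact/corner_scale/(cornerFF PQP).
- move=> y yPQ; have xEF := pl_EFV plP yPQ.
  have [Py yQ] := yPQ; have [Ex xF] := xEF.
  have lyE : lie (l d) (lie (l d) y) = lie (l (d * d)) y.
    rewrite -[y](ltripleVK lP) -!pl_lieEF//; last exact: corner_lieEF EFP _ _.
    congr l; have xd : l' y * d = 0.
      by rewrite -xF -dE.1 mulrA -[_ * F * E]mulrA (peirceFE EFP) mulr0 mul0r.
    by rewrite /lie mulrBr !mulrBl xd !mulrA xd -[d * _ * d]mulrA xd !mul0r mulr0 !subr0.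
  have Pa (t : A') : P * t = t * P -> P * t * P * y = t * y.
    by move=> Pt; rewrite Pt -!mulrA !Py.
  have aQ (t : A') : Q * t = t * Q -> y * (Q * t * Q) = y * t.
    by move=> Qt; rewrite !mulrA yQ -mulrA -Qt mulrA yQ.
  rewrite Pa// -(mulrA _ y) aQ// -(mulrA h) Pa; last first.
    by rewrite mulrBr mulrBl Pdd; congr (_ - _); rewrite mulrA Pd -!mulrA Pd.
  rewrite (mulrA y) -(scalarC iotaP') -(mulrA h) aQ; last first.
    by rewrite mulrDr mulrDl Qdd; congr (_ + _); rewrite mulrA Qd -!mulrA Qd.
  rewrite -mulrDr.
  transitivity (h * (l d * y * l d) + h * (l d * y * l d)).
    by rewrite -mulrDl scalar_half// mul1r mulrA.
  rewrite -mulrDr; congr (_ * _); move: lyE; rewrite /lie => /eqP.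
  rewrite -subr_eq0 => /eqP lyE.
  apply/eqP; rewrite -subr_eq0 -{1}oppr0 -lyE; apply/eqP; nc_ring.
- move=> [k dk]; right; exists k.
  have -> : l d - iota' k = Q * (l d - iota' k) * Q; last exact: cornerFF PQP _.
  rewrite mulrBr mulrBl -(scalarC iotaP' k) -(mulrA (iota' k)) QQ {1}ldE dk.
  rewrite (addrC (iota' k * P)) -addrA; congr (_ + _).
  by rewrite -{2}[iota' k]mulr1 -(peirce_sum PQP) mulrDr opprD addrA subrr add0r.
- move=> [k dk]; left; exists k.
  have -> : l d - iota' k = P * (l d - iota' k) * P; last exact: cornerEE PQP _.
  rewrite mulrBr mulrBl -(scalarC iotaP' k) -(mulrA (iota' k)) PP {1}ldE dk.
  rewrite -addrA; congr (_ + _).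
  by rewrite -{2}[iota' k]mulr1 -(peirce_sum PQP) mulrDr opprD addrCA subrr addr0.
Qed.

End PeirceLieTheory.

(** A group is not the union of two proper subgroups: with x outside S1 and y outside S2, the sum x
    + y could lie in neither. This turns elementwise alternatives into uniform ones. *)
Lemma additive_union (A : zmodType) (C S1 S2 : A -> Prop) :
  (forall x y, C x -> C y -> C (x + y)) ->
  (forall x y, S1 x -> S1 y -> S1 (x - y)) ->
  (forall x y, S2 x -> S2 y -> S2 (x - y)) ->
  (forall x, C x -> S1 x \/ S2 x) ->
  (forall x, C x -> S1 x) \/ (forall x, C x -> S2 x).
Proof.
move=> CD S1B S2B CS; have [|/existsNP[x /not_implyP[Cx S1x]]] :=
  pselect (forall x, C x -> S1 x); first by left.
right=> y Cy; have [//|S2x] := CS _ Cx.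
have [S1y|//] := CS _ Cy.
have [S1xy|S2xy] := CS _ (CD _ _ Cx Cy).
  by case: S1x; rewrite -(addrK y x); exact: S1B.
have -> : y = x + y - x by rewrite addrAC subrr add0r.
 exact: S2B.
Qed.

(* In the opposite ring the corners EAF and FAE trade places, and -l becomes a
   Lie triple map into the opposite ring; this reduces every case below to the
   one where l preserves the corners. *)
Lemma scalars_op (K : numFieldType) (A : pzRingType) (iota : K -> A) :
  scalars iota -> @scalars K A^c iota.
Proof.
move=> iP; split; [exact: scalarD iP| |exact: scalar1 iP|].
  by move=> x y; rewrite [x * y]mulrC; exact: (scalarM iP).
by move=> k x; symmetry; exact: (scalarC iP).
Qed.

Lemma peirce_op (K : numFieldType) (A : pzRingType) (iota : K -> A) (E F : A) :
  peirce iota E F -> @peirce K A^c iota F E.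
Proof.
move=> EFP; split.
- exact: scalars_op (peirce_scalars EFP).
- exact: peirceFF EFP.
- by rewrite addrC; exact: peirce_sum EFP.
- exact: peirce_neq0r EFP.
- exact: peirce_neq0l EFP.
- move=> a b c d [Fa aF] [Eb bE] [Fc cF] [Ed dE] xab.
  have [|||||[k bk]|[k ak]] := @peirce_tensor _ _ _ _ _ EFP b a d c.
  + by split.
  + by split.
  + by split.
  + by split.
  + move=> x [Ex xF]; have := xab x (conj xF Ex).
    change (@GRing.mul A b (@GRing.mul A x a) = @GRing.mul A x c + @GRing.mul A d x ->
      @GRing.mul A (@GRing.mul A b x) a = @GRing.mul A d x + @GRing.mul A x c).
    by rewrite mulrA => ->; rewrite addrC.
  + by right; exists k; rewrite bk; exact: (scalarC (peirce_scalars EFP)).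
  + by left; exists k; rewrite ak; exact: (scalarC (peirce_scalars EFP)).
- move=> c d [Fc cF] [Ed dE] xcd.
  have [|||k [dk ck]] := @peirce_balanced _ _ _ _ _ EFP d c.
  + by split.
  + by split.
  + by move=> x [Ex xF]; have := xcd x (conj xF Ex) => /esym.
  exists k; rewrite dk ck.
  by split; exact: (scalarC (peirce_scalars EFP)).
Qed.

Lemma lie_op (A : pzRingType) (x y : A) : @lie A^c x y = - lie x y.
Proof. by rewrite /lie opprB. Qed.

Lemma lie2_op (A : pzRingType) (x y z : A) :
  @lie A^c (@lie A^c x y) z = lie (lie x y) z.
Proof. by rewrite !lie_op /lie; nc_ring. Qed.

Section Opposite.
Variables (K : numFieldType) (A A' : pzRingType).
Variables (iota : K -> A) (iota' : K -> A') (E F : A) (P Q : A').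
Variables (l : A -> A') (l' : A' -> A).
Hypothesis plP : peirce_lie iota iota' E F P Q l l'.
Let lP := pl_lte plP.
Let EFP := pl_src plP.
Let PQP := pl_tgt plP.
Let iotaP := peirce_scalars EFP.
Let iotaP' := peirce_scalars PQP.

Lemma peirce_lie_op : @peirce_lie K A^c A'^c iota iota' F E Q P l l'.
Proof.
split.
- split; [|exact: (ltripleK lP)|exact: (ltripleVK lP)|].
  + move=> k x y.
    change (l (@GRing.mul A x (iota k) + y) = @GRing.mul A' (l x) (iota' k) + l y).
    by rewrite -!scalarC//; exact: (ltriple_lin lP).
  + by move=> x y z; rewrite !lie2_op; exact: (ltriple_lie lP).
- exact: peirce_op.
- exact: peirce_op.
- have [k lE] := pl_idem plP.
  have [k' lk] := ltriple_scalar iotaP iotaP' lP 1 PQP.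
  exists (k' - k - 1).
  change (l F = Q + iota' (k' - k - 1)).
  rewrite !(scalarD iotaP', scalarN iotaP') -lk !scalar1// (peirceF PQP).
  rewrite -(peirce_sum EFP) (ltripleD iotaP iotaP' lP) lE; nc_ring.
- by move=> x [Fx xE]; have [] := pl_EF plP (conj xE Fx); split.
- by move=> x [Fx xE]; have [] := pl_FE plP (conj xE Fx); split.
Qed.

(** The sign serves the idempotent: -P is Q up to a scalar, and PA'Q is the corner from Q to P of
    the opposite ring. Second commutators agree in a ring and its opposite, and being trilinear they
    change sign with the map. *)
Lemma peirce_lie_negop :
  @peirce_lie K A A'^c iota iota' E F Q P (fun x => - l x) (fun y => l' (- y)).
Proof.
split.
- split.
  + move=> k x y; change (- l (iota k * x + y) = @GRing.mul A' (- l x) (iota' k) - l y).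
    by rewrite -scalarC// (ltriple_lin lP) mulrN -opprD.
  + by move=> x; rewrite opprK (ltripleK lP).
  + by move=> x; rewrite (ltripleVK lP) opprK.
  + move=> x y z; rewrite lie2_op (ltriple_lie lP).
    by rewrite /lie; nc_ring.
- exact: EFP.
- exact: peirce_op.
- have [k lE] := pl_idem plP.
  exists (- 1 - k); change (- l E = Q + iota' (- 1 - k)).
  rewrite lE scalarD// !scalarN// scalar1// (peirceF PQP); nc_ring.
- move=> x /(pl_EF plP)[Plx lxQ].
  change ((- l x) * Q = - l x /\ P * (- l x) = - l x).
  by rewrite mulNr mulrN Plx lxQ.
- move=> x /(pl_FE plP)[Plx lxQ].
  change ((- l x) * P = - l x /\ Q * (- l x) = - l x).
  by rewrite mulNr mulrN Plx lxQ.
Qed.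

End Opposite.

(** * Removing the scalar part when diagonal corners go to matching diagonal corners *)

Section Splitting.
Variables (K : numFieldType) (A A' : pzRingType).
Variables (iota : K -> A) (iota' : K -> A') (E F : A) (P Q : A').
Variables (l : A -> A') (l' : A' -> A).
Hypothesis plP : peirce_lie iota iota' E F P Q l l'.
Let lP := pl_lte plP.
Let EFP := pl_src plP.
Let PQP := pl_tgt plP.
Let iotaP := peirce_scalars EFP.
Let iotaP' := peirce_scalars PQP.
Let lD := ltripleD iotaP iotaP' lP.
Let lN := ltripleN iotaP iotaP' lP.
Let l0 := ltriple0 iotaP iotaP' lP.

Hypothesis lEE : forall x, corner E E x -> exists k, corner P P (l x - iota' k).
Hypothesis lFF : forall x, corner F F x -> exists k, corner Q Q (l x - iota' k).

Lemma cornerEE_scalar (B : pzRingType) (kappa : K -> B) (G H : B) k :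
  peirce kappa G H -> corner G G (kappa k) -> k = 0.
Proof.
move=> GHP [_ kG]; apply/eqP/negPn/negP => k0; apply: (peirce_neq0r GHP).
apply: (scalarI (peirce_scalars GHP) k0).
by rewrite -kG -mulrA (peirceEF GHP) mulr0.
Qed.

Lemma cornerFF_scalar (B : pzRingType) (kappa : K -> B) (G H : B) k :
  peirce kappa G H -> corner H H (kappa k) -> k = 0.
Proof.
move=> GHP [_ kG]; apply/eqP/negPn/negP => k0; apply: (peirce_neq0l GHP).
apply: (scalarI (peirce_scalars GHP) k0).
by rewrite -kG -mulrA (peirceFE GHP) mulr0.
Qed.

(** For linearity of the scalar correction: the discrepancy between two corrections is a scalar
    inside GA'G, and for G = P or Q such a scalar is 0. *)
Lemma corner_shift_lin (G : A') (u v : A') k1 k2 k3 c :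
  corner G G (u - iota' k1) -> corner G G (v - iota' k2) ->
  corner G G (iota' c * u + v - iota' k3) ->
  corner G G (iota' (k3 - (c * k1 + k2))).
Proof.
move=> Gu Gv Guv.
have -> : iota' (k3 - (c * k1 + k2)) =
    iota' c * (u - iota' k1) + (v - iota' k2) - (iota' c * u + v - iota' k3).
  by rewrite !(scalarD iotaP', scalarN iotaP', scalarM iotaP'); nc_ring.
by apply: corner_sub => //; apply: corner_add => //; exact: corner_scale.
Qed.

Lemma cornerM (B : pzRingType) (X Y Z T x y : B) :
  corner X Y x -> corner Z T y -> corner X T (x * y).
Proof.
by move=> [Xx xY] [Zy yT]; split; [rewrite mulrA Xx|rewrite -mulrA yT].
Qed.

(** The correction is unique on each diagonal corner, hence linear. Multiplicativity is read off
    from [d, x] with x off-diagonal, where one of the two products vanishes, and then passes to EAE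
    and FAF because they act faithfully on EAF. *)
Lemma pl_splitting : exists (m : A -> A') (n : A -> K),
  [/\ forall x, l x = m x + iota' (n x),
      forall k x y, m (iota k * x + y) = iota' k * m x + m y,
      bijective m & forall x y, m (x * y) = m x * m y].
Proof.
have /choice[n1 n1P] x : exists k, corner P P (l (E * x * E) - iota' k).
  exact/lEE/(cornerEE EFP).
have /choice[n2 n2P] x : exists k, corner Q Q (l (F * x * F) - iota' k).
  exact/lFF/(cornerFF EFP).
have n1L k x y : n1 (iota k * x + y) = k * n1 x + n1 y.
  apply/eqP; rewrite -subr_eq0; apply/eqP/(cornerEE_scalar PQP).
  apply: (corner_shift_lin (n1P x) (n1P y)); rewrite -(ltriple_lin lP).
  have := n1P (iota k * x + y); congr (corner _ _ (l _ - _)).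
  by rewrite mulrDr mulrDl !mulrA (scalarC iotaP k).
have n2L k x y : n2 (iota k * x + y) = k * n2 x + n2 y.
  apply/eqP; rewrite -subr_eq0; apply/eqP/(cornerFF_scalar PQP).
  apply: (corner_shift_lin (n2P x) (n2P y)); rewrite -(ltriple_lin lP).
  have := n2P (iota k * x + y); congr (corner _ _ (l _ - _)).
  by rewrite mulrDr mulrDl !mulrA (scalarC iotaP k).
pose n x := n1 x + n2 x; pose m x := l x - iota' (n x).
have lm x : l x = m x + iota' (n x) by rewrite subrK.
have n1_0 x : E * x * E = 0 -> n1 x = 0.
  move=> ExE; apply/eqP; rewrite -oppr_eq0; apply/eqP/(cornerEE_scalar PQP).
  by have := n1P x; rewrite ExE l0 sub0r scalarN.
have n2_0 x : F * x * F = 0 -> n2 x = 0.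
  move=> ExE; apply/eqP; rewrite -oppr_eq0; apply/eqP/(cornerFF_scalar PQP).
  by have := n2P x; rewrite ExE l0 sub0r scalarN.
have mL k x y : m (iota k * x + y) = iota' k * m x + m y.
  rewrite /m /n (ltriple_lin lP) n1L n2L.
  by rewrite !(scalarD iotaP', scalarM iotaP'); nc_ring.
have mD : {morph m : x y / x + y}.
  by move=> x y; have := mL 1 x y; rewrite !scalar1// !mul1r.
have m0 : m 0 = 0 by apply: (addrI (m 0)); rewrite -mD !addr0.
have EF0 := peirceEF EFP; have FE0 := peirceFE EFP.
have mEE x : corner E E x -> corner P P (m x).
  move=> [Ex xE]; rewrite /m /n n2_0; last by rewrite -Ex !mulrA FE0 !mul0r.
  by rewrite addr0; have := n1P x; rewrite Ex xE.
have mFF x : corner F F x -> corner Q Q (m x).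
  move=> [Ex xE]; rewrite /m /n n1_0; last by rewrite -Ex !mulrA EF0 !mul0r.
  by rewrite add0r; have := n2P x; rewrite Ex xE.
have mlEF x : corner E F x -> m x = l x.
  move=> [Ex xF]; rewrite /m /n n1_0 ?n2_0 ?addr0 ?scalar0 ?subr0//.
    by rewrite -Ex !mulrA FE0 !mul0r.
  by rewrite -xF -!mulrA FE0 !mulr0.
have mlFE x : corner F E x -> m x = l x.
  move=> [Ex xF]; rewrite /m /n n1_0 ?n2_0 ?addr0 ?scalar0 ?subr0//.
    by rewrite -xF -!mulrA EF0 !mulr0.
  by rewrite -Ex !mulrA EF0 !mul0r.
have mEF x : corner E F x -> corner P Q (m x).
  by move=> xEF; rewrite mlEF//; exact: (pl_EF plP).
have mFE x : corner F E x -> corner Q P (m x).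
  by move=> xEF; rewrite mlFE//; exact: (pl_FE plP).
have lie_lm x y : lie (l x) (l y) = lie (m x) (m y).
  by rewrite !lm !(lieD, lieDl, lie_scalar iotaP', lie_scalar_r iotaP') !addr0.
have mEEEF d x : corner E E d -> corner E F x -> m (d * x) = m d * m x.
  move=> dEE xEF; have := pl_lieEF plP (cornerEE_comm dEE) xEF.
  rewrite lie_lm /lie (corner_mul0' EFP xEF dEE) subr0.
  rewrite (corner_mul0' PQP (mEF _ xEF) (mEE _ dEE)) subr0 => <-.
  by rewrite mlEF//; exact: cornerM dEE xEF.
have mEFFF x d : corner E F x -> corner F F d -> m (x * d) = m x * m d.
  move=> xEF dFF; have := pl_lieEF plP (cornerFF_comm EFP dFF) xEF.
  rewrite lie_lm /lie (corner_mul0' EFP dFF xEF) sub0r lN => /eqP.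
  rewrite (corner_mul0' PQP (mFF _ dFF) (mEF _ xEF)) sub0r eqr_opp => /eqP <-.
  by rewrite mlEF//; exact: cornerM xEF dFF.
have mFFFE d x : corner F F d -> corner F E x -> m (d * x) = m d * m x.
  move=> dFF xFE; have := pl_lieFE plP (cornerFF_comm EFP dFF) xFE.
  rewrite lie_lm /lie (corner_mul0 EFP xFE dFF) subr0.
  rewrite (corner_mul0 PQP (mFE _ xFE) (mFF _ dFF)) subr0 => <-.
  by rewrite mlFE//; exact: cornerM dFF xFE.
have mFEEE x d : corner F E x -> corner E E d -> m (x * d) = m x * m d.
  move=> xFE dEE; have := pl_lieFE plP (cornerEE_comm dEE) xFE.
  rewrite lie_lm /lie (corner_mul0 EFP dEE xFE) sub0r lN => /eqP.
  rewrite (corner_mul0 PQP (mEE _ dEE) (mFE _ xFE)) sub0r eqr_opp => /eqP <-.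
  by rewrite mlFE//; exact: cornerM xFE dEE.
have mEFV y : corner P Q y -> exists2 x, corner E F x & y = m x.
  move=> yPQ; exists (l' y); first exact: (pl_EFV plP yPQ).
  by rewrite mlEF ?(ltripleVK lP)//; exact: (pl_EFV plP).
have mEEEE d e : corner E E d -> corner E E e -> m (d * e) = m d * m e.
  move=> dE eE; have deE := cornerM dE eE.
  apply/eqP; rewrite -subr_eq0; apply/eqP/(faithfull PQP).
    by apply: corner_sub; [exact: mEE|exact: cornerM (mEE _ dE) (mEE _ eE)].
  move=> _ /mEFV[x xEF ->]; rewrite mulrBl -mEEEF// -!mulrA -!mEEEF ?subrr//.
  exact: cornerM eE xEF.
have mFFFF d e : corner F F d -> corner F F e -> m (d * e) = m d * m e.
  move=> dE eE; have deE := cornerM dE eE.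
  apply/eqP; rewrite -subr_eq0; apply/eqP/(faithfulr PQP).
    by apply: corner_sub; [exact: mFF|exact: cornerM (mFF _ dE) (mFF _ eE)].
  move=> _ /mEFV[x xEF ->]; rewrite mulrBr -mEFFF// !mulrA -!mEFFF ?subrr//.
  exact: cornerM xEF dE.
(* For z in EAF the products xz and zx vanish, so [[x, y], z] = xyz + zyx. Hence the defects of m at
   xy and at yx act on PA'Q as opposite maps, and balancing makes them kP and -kQ. *)
have mEFFE x y : corner E F x -> corner F E y ->
    m (x * y) = m x * m y /\ m (y * x) = m y * m x.
  move=> xEF yFE.
  have xyE := cornerM xEF yFE.
  have yxF := cornerM yFE xEF.
  have mxyE := cornerM (mEF _ xEF) (mFE _ yFE).
  have myxF := cornerM (mFE _ yFE) (mEF _ xEF).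
  have [|||k [xyk yxk]] := peirce_balanced PQP (c := m (x * y) - m x * m y)
    (d := - (m (y * x) - m y * m x)).
  - by apply: corner_sub => //; exact: mEE.
  - by rewrite opprB; apply: corner_sub => //; exact: mFF.
  - move=> _ /mEFV[z zEF ->].
    have triple (B : pzRingType) (u v w : B) : u * w = 0 -> w * u = 0 ->
        lie (lie u v) w = u * v * w + w * (v * u).
      move=> uw wu; rewrite /lie !(mulrBl, mulrBr) !mulrA wu mul0r.
      by rewrite -(mulrA v u w) uw mulr0 !subr0 sub0r opprK.
    have := ltriple_lie lP x y z; rewrite -(mlEF _ xEF) -(mlFE _ yFE) -(mlEF _ zEF).
    rewrite (triple _ _ _ _ (corner_mul0' EFP xEF zEF) (corner_mul0' EFP zEF xEF)).
    rewrite (triple _ _ _ _ (corner_mul0' PQP (mEF _ xEF) (mEF _ zEF))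
      (corner_mul0' PQP (mEF _ zEF) (mEF _ xEF))).
    rewrite lD -(mlEF _ (cornerM xyE zEF)) -(mlEF _ (cornerM zEF yxF)).
    rewrite (mEEEF _ _ xyE zEF) (mEFFF _ _ zEF yxF) => /eqP.
    rewrite -subr_eq0 => /eqP xyz.
    by apply/eqP; rewrite -subr_eq0 -xyz; apply/eqP; nc_ring.
  (* Associativity (xy)x = x(yx) compares the two defects: k m(x) is computed once from each side,
     and the sum is m(xyx) - m(xyx). *)
  have mxk : iota' k * m x + iota' k * m x = 0.
    have mxyx : m (x * y) * m x - m x * m (y * x) = 0.
      by rewrite -(mEFFF _ _ xEF yxF) -(mEEEF _ _ xyE xEF) mulrA subrr.
    have [Pmx mxQ] := mEF _ xEF.
    have kP : iota' k * m x = (m (x * y) - m x * m y) * m x.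
      by rewrite xyk -mulrA Pmx.
    have kQ : iota' k * m x = m x * - (m (y * x) - m y * m x).
      by rewrite yxk mulrA -scalarC// -mulrA mxQ.
    rewrite {1}kP kQ -mxyx; nc_ring.
  move: xyk yxk.
  have [->|k0] := eqVneq k 0.
    by rewrite scalar0// !mul0r => /eqP + /eqP; rewrite oppr_eq0 !subr_eq0 => /eqP ? /eqP.
  have mx0 : m x = 0.
    apply: (scalarI iotaP' k0); apply: (doubler_eq0 iotaP'); exact: mxk.
  have -> : x = 0 by apply: (ltripleI lP); rewrite -mlEF// mx0 l0.
  by rewrite m0 !(mul0r, mulr0) m0.
have mE_ : m E = P.
  have EE : corner E E E by split; exact: peirce_idem EFP.
  apply/eqP; rewrite -subr_eq0; apply/eqP/(faithfull PQP).
    by apply: corner_sub; [exact: mEE|split; exact: peirce_idem PQP].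
  move=> _ /mEFV[x xEF ->]; rewrite mulrBl -mEEEF//.
  by have [-> _] := xEF; have [-> _] := mEF _ xEF; rewrite subrr.
have mF_ : m F = Q.
  have EE : corner F F F by split; exact: peirceFF EFP.
  apply/eqP; rewrite -subr_eq0; apply/eqP/(faithfulr PQP).
    by apply: corner_sub; [exact: mFF|split; exact: peirceFF PQP].
  move=> _ /mEFV[x xEF ->]; rewrite mulrBr -mEFFF//.
  by have [_ ->] := xEF; have [_ ->] := mEF _ xEF; rewrite subrr.
have m_scalar k : m (iota k) = iota' k.
  rewrite -[iota k]mulr1 -[_ * 1]addr0 mL m0 addr0 -(peirce_sum EFP) mD mE_ mF_.
  by rewrite (peirce_sum PQP) mulr1.
have mI : injective m.
  move=> x y xy; apply/eqP; rewrite -subr_eq0; apply/eqP; set z := x - y.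
  have mz : m z = 0.
    have := mL (- 1) y x; rewrite !scalarN// !scalar1// !mulN1r xy addNr.
    by rewrite addrC.
  have [c zc] := ltriple_scalar iotaP' iotaP (ltriple_inv lP) (n z) EFP.
  have {}zc : z = iota c by rewrite -zc -[LHS](ltripleK lP) lm mz add0r.
  by move: mz; rewrite zc m_scalar => /(scalar_inj PQP) ->; exact: scalar0.
(* m(l' y) falls short of y by the scalar n(l' y), and m carries each scalar to the same scalar, so
   adding it before applying m repairs this. *)
pose g y := l' y + iota (n (l' y)).
have gK : cancel g m by move=> y; rewrite mD m_scalar -lm (ltripleVK lP).
exists m, n; split=> //.
  by exists g => // x; apply: mI; rewrite gK.
move=> x y; rewrite (peirce_decomp EFP x) (peirce_decomp EFP y).
have EE z := cornerEE EFP z; have EF z := cornerEF EFP z.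
have FE z := cornerFE EFP z; have FF z := cornerFF EFP z.
move: (EE x) (EF x) (FE x) (FF x) (EE y) (EF y) (FE y) (FF y).
move: (E * x * E) (E * x * F) (F * x * E) (F * x * F) => x1 x2 x3 x4.
move: (E * y * E) (E * y * F) (F * y * E) (F * y * F) => y1 y2 y3 y4.
move=> X1 X2 X3 X4 Y1 Y2 Y3 Y4.
clearbody m; rewrite !(mulrDl, mulrDr, mD).
have m_zero u v : u * v = 0 -> m u * m v = 0 -> m (u * v) = m u * m v.
  by move=> -> ->.
have ml0 X Y u v : corner X E u -> corner F Y v -> m u * m v = 0 ->
    m (u * v) = m u * m v.
  by move=> uX vY; apply: m_zero; exact: (corner_mul0 EFP uX vY).
have mr0 X Y u v : corner X F u -> corner E Y v -> m u * m v = 0 ->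
    m (u * v) = m u * m v.
  by move=> uX vY; apply: m_zero; exact: (corner_mul0' EFP uX vY).
rewrite (mEEEE _ _ X1 Y1) (mEEEF _ _ X1 Y2).
rewrite (ml0 _ _ _ _ X1 Y3 (corner_mul0 PQP (mEE _ X1) (mFE _ Y3))).
rewrite (ml0 _ _ _ _ X1 Y4 (corner_mul0 PQP (mEE _ X1) (mFF _ Y4))).
rewrite (mr0 _ _ _ _ X2 Y1 (corner_mul0' PQP (mEF _ X2) (mEE _ Y1))).
rewrite (mr0 _ _ _ _ X2 Y2 (corner_mul0' PQP (mEF _ X2) (mEF _ Y2))).
rewrite (mEFFE _ _ X2 Y3).1 (mEFFF _ _ X2 Y4).
rewrite (mFEEE _ _ X3 Y1) (mEFFE _ _ Y2 X3).2.
rewrite (ml0 _ _ _ _ X3 Y3 (corner_mul0 PQP (mFE _ X3) (mFE _ Y3))).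
rewrite (ml0 _ _ _ _ X3 Y4 (corner_mul0 PQP (mFE _ X3) (mFF _ Y4))).
rewrite (mr0 _ _ _ _ X4 Y1 (corner_mul0' PQP (mFF _ X4) (mEE _ Y1))).
rewrite (mr0 _ _ _ _ X4 Y2 (corner_mul0' PQP (mFF _ X4) (mEF _ Y2))).
rewrite (mFFFE _ _ X4 Y3) (mFFFF _ _ X4 Y4); nc_ring.
Qed.

End Splitting.

(** Linearity of [n] and its vanishing on second commutators are left out: both are recovered at the
    end from n = l - m or n = l + m. *)
Definition lie_standard (K : numFieldType) (A A' : pzRingType)
    (iota : K -> A) (iota' : K -> A') (l : A -> A') :=
  exists (m : A -> A') (n : A -> K),
  [/\ forall k x y, m (iota k * x + y) = iota' k * m x + m y,
      bijective m,
      (forall x y, m (x * y) = m x * m y) \/ (forall x y, m (x * y) = m y * m x) &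
      (forall x, l x = m x + iota' (n x)) \/ (forall x, l x = - m x + iota' (n x))].

Lemma lie_standard_negop (K : numFieldType) (A A' : pzRingType)
    (iota : K -> A) (iota' : K -> A') (l : A -> A') :
  scalars iota' -> @lie_standard K A A'^c iota iota' (fun x => - l x) ->
  lie_standard iota iota' l.
Proof.
move=> iP [m [n [mL mB mM lmn]]]; exists m, (fun x => - n x); split => //.
- by move=> k x y; rewrite mL (scalarC iP).
- by case: mM => mM; [right|left] => x y; rewrite mM.
- case: lmn => lmn; [right|left] => x; apply: oppr_inj; rewrite lmn scalarN//.
    by rewrite opprD !opprK.
  by rewrite opprD opprK.
Qed.

Lemma lie_standard_neg (K : numFieldType) (A A' : pzRingType)
    (iota : K -> A) (iota' : K -> A') (l : A -> A') :
  scalars iota' -> lie_standard iota iota' (fun x => - l x) ->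
  lie_standard iota iota' l.
Proof.
move=> iP [m [n [mL mB mM lmn]]]; exists m, (fun x => - n x); split => //.
by case: lmn => lmn; [right|left] => x; apply: oppr_inj; rewrite lmn scalarN//;
  rewrite opprD !opprK.
Qed.

Lemma pl_alternative (K : numFieldType) (A A' : pzRingType)
    (iota : K -> A) (iota' : K -> A') (E F : A) (P Q : A')
    (l : A -> A') (l' : A' -> A) :
  peirce_lie iota iota' E F P Q l l' ->
  (forall x, corner E E x -> exists k, corner P P (l x - iota' k)) \/
  (forall x, corner E E x -> exists k, corner Q Q (l x - iota' k)).
Proof.
move=> plP; have iotaP := peirce_scalars (pl_src plP).
have iotaP' := peirce_scalars (pl_tgt plP).
have lB := ltripleB iotaP iotaP' (pl_lte plP).
have subG G x y : (exists k, corner G G (l x - iota' k)) ->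
    (exists k, corner G G (l y - iota' k)) ->
    exists k, corner G G (l (x - y) - iota' k).
  move=> [k xk] [k' yk']; exists (k - k').
  have -> : l (x - y) - iota' (k - k') = l x - iota' k - (l y - iota' k').
    by rewrite lB scalarD// scalarN//; nc_ring.
  exact: corner_sub.
apply: additive_union => [x y|||x]; [exact: corner_add|exact: subG|exact: subG|].
exact: pl_dichotomy plP _.
Qed.

Lemma corner_op (A : pzRingType) (X Y x : A) :
  @corner A^c X Y x <-> corner Y X x.
Proof. by split=> -[? ?]. Qed.

Section Standard.
Variables (K : numFieldType) (A A' : pzRingType).
Variables (iota : K -> A) (iota' : K -> A') (E F : A) (P Q : A').
Variables (l : A -> A') (l' : A' -> A).
Hypothesis plP : peirce_lie iota iota' E F P Q l l'.
Let lP := pl_lte plP.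
Let EFP := pl_src plP.
Let PQP := pl_tgt plP.
Let iotaP := peirce_scalars EFP.
Let iotaP' := peirce_scalars PQP.

Lemma corner_complement (B : pzRingType) (kappa : K -> B) (G H x : B) k :
  scalars kappa -> G + H = 1 -> G * H = 0 ->
  corner G G (x - kappa k) -> corner H H x -> x = kappa k * H.
Proof.
move=> kP GH1 GH0 [Gx _] [Hx _]; have Gx0 : G * x = 0 by rewrite -Hx mulrA GH0 mul0r.
move: Gx; rewrite mulrBr Gx0 sub0r -scalarC// => /eqP; rewrite -subr_eq0 => /eqP Gx.
have -> : H = 1 - G by rewrite -GH1 addrAC subrr add0r.
rewrite -[x]addr0 -Gx; nc_ring.
Qed.

(** The obstacle is that FAF may also go to PA'P + C. Then l' sends PA'P back into EAE + C or FAF +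
    C, so FAF or EAE, respectively, consists of multiples of its idempotent. Since l(E) and l(F) are
    scalars plus either of P, Q up to sign, that small corner also goes to QA'Q + C, and the
    situation is straight or crosswise. *)
Lemma lie_standard_EE :
  (forall x, corner E E x -> exists k, corner P P (l x - iota' k)) ->
  lie_standard iota iota' l.
Proof.
move=> lEE.
have good : (forall x, corner F F x -> exists k, corner Q Q (l x - iota' k)) ->
    lie_standard iota iota' l.
  move=> lFF; have [m [n [lmn mL mB mM]]] := pl_splitting plP lEE lFF.
  by exists m, n; split=> //; left.
have [lFF|lFP] := pl_alternative (peirce_lie_op plP).
  by apply: good => x /corner_op/lFF[k /corner_op]; exists k.
have {}lFP x : corner F F x -> exists k, corner P P (l x - iota' k).
  by move=> /corner_op/lFP[k /corner_op]; exists k.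
have l'_shift x k : corner P P (l x - iota' k) ->
    exists2 p, corner P P p & exists k', x = l' p + iota k'.
  move=> xk; exists (l x - iota' k) => //.
  have [k' l'k] := ltriple_scalar iotaP' iotaP (ltriple_inv lP) k EFP.
  exists k'; rewrite -l'k; apply: (ltripleI lP).
  by rewrite (ltripleD iotaP iotaP' lP) !(ltripleVK lP) subrK.
have [l'E|l'F] := pl_alternative (pl_inv plP).
  apply: good => f fF; have [k fk] := lFP f fF.
  have [p pP [k' fE]] := l'_shift _ _ fk; have [k2 pE] := l'E _ pP.
  have [c lF] := pl_idem (peirce_lie_op plP).
  have {}fE : f = iota (k' + k2) * F.
    apply: (corner_complement iotaP (peirce_sum EFP) (peirceEF EFP)) fF.
    rewrite fE scalarD//.
    by have -> : l' p + iota k' - (iota k' + iota k2) = l' p - iota k2 by nc_ring.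
  exists ((k' + k2) * c); rewrite fE (ltripleZ iotaP iotaP' lP) lF.
  rewrite scalarM// mulrDr addrK; apply: corner_scale => //.
  by split; exact: peirceFF PQP.
apply: (lie_standard_negop iotaP').
have plN := peirce_lie_negop plP.
have [|f fF|m [n [lmn mL mB mM]]] := pl_splitting plN.
- move=> e eE; have [k ek] := lEE e eE.
  have [p pP [k' eP]] := l'_shift _ _ ek; have [k2 pF] := l'F _ pP.
  have [c lE] := pl_idem plP.
  have {}eP : e = iota (k' + k2) * E.
    apply: (corner_complement iotaP _ (peirceFE EFP)) eE.
      by rewrite addrC (peirce_sum EFP).
    rewrite eP scalarD//.
    by have -> : l' p + iota k' - (iota k' + iota k2) = l' p - iota k2 by nc_ring.
  (* With e = tE and l(E) = P + c, one has -l(e) = -t(1 - Q + c) = tQ - t(1 + c). *)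
  exists (- (k' + k2) * (1 + c)).
  have -> : - l e - iota' (- (k' + k2) * (1 + c)) = iota' (k' + k2) * Q.
    rewrite eP (ltripleZ iotaP iotaP' lP) lE !(scalarM iotaP', scalarN iotaP').
    by rewrite (scalarD iotaP' 1) scalar1// (peirceF PQP); nc_ring.
  have [QQ QQ'] : corner Q Q (iota' (k' + k2) * Q).
    by apply: corner_scale => //; split; exact: peirceFF PQP.
  by split.
- have [k [Pk kP]] := lFP f fF; exists (- k).
  apply/corner_op; rewrite scalarN// -opprD.
  by split; rewrite ?mulNr ?mulrN ?Pk ?kP.
by exists m, n; split=> //; left.
Qed.

End Standard.

Theorem peirce_lie_standard (K : numFieldType) (A A' : pzRingType)
    (iota : K -> A) (iota' : K -> A') (E F : A) (P Q : A')
    (l : A -> A') (l' : A' -> A) :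
  peirce_lie iota iota' E F P Q l l' -> lie_standard iota iota' l.
Proof.
move=> plP; have iotaP' := peirce_scalars (pl_tgt plP).
have [|lEQ] := pl_alternative plP; first exact: lie_standard_EE plP.
apply: (lie_standard_negop iotaP').
apply: (lie_standard_EE (peirce_lie_negop plP)) => x /lEQ[k [Qx xQ]].
exists (- k); apply/corner_op; rewrite scalarN// -opprD.
by split; rewrite ?mulNr ?mulrN ?Qx ?xQ.
Qed.

(** * The preimage of an idempotent *)

Section AdIdentities.
Variables (K : numFieldType) (A : pzRingType) (iota : K -> A).
Hypothesis iotaP : scalars iota.
Implicit Types a x y z : A.

Lemma lieMr a x y : lie a (x * y) = lie a x * y + x * lie a y.
Proof. by rewrite /lie; nc_ring. Qed.

Lemma lie_iota a x c : lie a (iota c * x) = iota c * lie a x.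
Proof. by rewrite lieMr lie_scalar_r// mul0r add0r. Qed.

Lemma scalar_nat n : iota n%:R = n%:R.
Proof.
by elim: n => [|n IH]; rewrite ?scalar0// -[n.+1]addn1 !natrD scalarD// IH scalar1.
Qed.

(** ad(a) is a derivation, so eigenvalues add under products; this kills every product whose
    eigenvalue would be 2, -2 or 3. *)
Lemma ad3_eigen a z c : (forall y, lie a (lie a (lie a y)) = lie a y) ->
  lie a z = iota c * z -> c ^+ 3 != c -> z = 0.
Proof.
move=> a3 az cn; apply: (scalarI iotaP (k := c ^+ 3 - c)); first by rewrite subr_eq0.
have := a3 z; rewrite !(az, lie_iota) !mulrA => /eqP.
rewrite -subr_eq0 -mulrBl -!scalarM// -scalarN// -scalarD//.
by rewrite [c * c * c](_ : _ = c ^+ 3) => [/eqP//|]; rewrite !exprS expr0 mulr1 mulrA.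
Qed.

End AdIdentities.

Section LieTripleIdempotent.
Variables (K : numFieldType) (A A' : pzRingType).
Variables (iota : K -> A) (iota' : K -> A') (G H : A) (P Q : A').
Variables (l : A -> A') (l' : A' -> A).
Hypothesis lP : lie_triple_equiv iota iota' l l'.
Hypothesis GHP : peirce iota G H.
Hypothesis PQP : peirce iota' P Q.
Let iotaP := peirce_scalars GHP.
Let iotaP' := peirce_scalars PQP.
Let lP' := ltriple_inv lP.
Let l'D := ltripleD iotaP' iotaP lP'.
Local Notation a := (l' P).

Lemma ltriple_lie2V x y z : l' (lie (lie x y) z) = lie (lie (l' x) (l' y)) (l' z).
Proof. exact: (ltriple_lie lP'). Qed.

Lemma ad2_offdiag x : lie (lie x P) P = x -> lie a (lie a (l' x)) = l' x.
Proof.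
move=> xPP; rewrite [lie a (l' x)]lieC lieN -lieC.
by rewrite -ltriple_lie2V xPP.
Qed.

Lemma offdiag_lie2 y : lie (lie (P * y * Q + Q * y * P) P) P = P * y * Q + Q * y * P.
Proof.
have uP := lie_cornerEF PQP (cornerEF PQP y).
have vP := lie_cornerFE PQP (cornerFE PQP y).
have -> : lie (P * y * Q + Q * y * P) P = - (P * y * Q) + Q * y * P.
  by rewrite lieDl uP vP.
by rewrite lieDl [lie (- _) P]lieC lieN -lieC uP vP opprK.
Qed.

Lemma diag_offdiag y : exists d x,
  [/\ y = d + x, P * d = d * P & lie (lie x P) P = x].
Proof.
exists (P * y * P + Q * y * Q), (P * y * Q + Q * y * P); split.
- by rewrite {1}(peirce_decomp PQP y); nc_ring.
- rewrite mulrDr mulrDl (cornerFF_comm PQP (cornerFF PQP y)).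
  by rewrite (cornerEE_comm (cornerEE PQP y)).
- exact: offdiag_lie2.
Qed.

Lemma ad_diag_scalar d : P * d = d * P -> exists c, lie a (l' d) = iota c.
Proof.
move=> /lie_eq0 Pd; apply: (centre_scalar GHP) => w; apply/lie_eq0.
by rewrite -[w](ltripleK lP) -ltriple_lie2V Pd lie0l; exact: (ltriple0 iotaP' iotaP lP').
Qed.

(* If [a, l' d] = c is a nonzero scalar, put e = l' d and split e^2 into its
   images of a diagonal and an off-diagonal part: [a, e^2] = 2ce then makes e a
   scalar. *)
Lemma ad_diag d : P * d = d * P -> lie a (l' d) = 0.
Proof.
move=> Pd; have [c ac] := ad_diag_scalar Pd.
have [c0|c0] := eqVneq c 0; first by rewrite ac c0 scalar0.
set e := l' d in ac *.
have [d2 [x2 [ddE Pd2 x2PP]]] := diag_offdiag (l (e * e)).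
have [c2 ac2] := ad_diag_scalar Pd2.
have eeE : e * e = l' d2 + l' x2 by rewrite -l'D -ddE (ltripleK lP).
have ce : iota c * e + iota c * e = iota c2 + lie a (l' x2).
  by rewrite -ac2 -lieD -eeE lieMr ac -(scalarC iotaP).
have := congr1 (lie a) ce.
rewrite [LHS]lieD [RHS]lieD lie_scalar_r// add0r (ad2_offdiag x2PP).
rewrite (lie_iota iotaP) ac => x2E.
have x20 : lie a (l' x2) = 0.
  by rewrite -x2E -!scalarM// -scalarD// lie_scalar_r.
have eE : e = iota (c^-1 * (2^-1 * c2)).
  have : iota c * e = iota (2^-1 * c2).
    rewrite scalarM// -[iota c2]addr0 -x20 -ce mulrDr -mulrDl.
    by rewrite scalar_half// mul1r.
  by rewrite (scalarM iotaP c^-1) => <-; rewrite mulrA scalarMV// mul1r.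
by rewrite -ac eE lie_scalar_r.
Qed.

(** ad(a) kills the images of elements commuting with P, and its square fixes the images of
    off-diagonal ones. *)
Lemma ad3 y : lie a (lie a (lie a y)) = lie a y.
Proof.
have [d [x [yE Pd xPP]]] := diag_offdiag (l y).
have -> : y = l' d + l' x by rewrite -l'D -yE (ltripleK lP).
by rewrite (lieD a (l' d)) (ad_diag Pd) add0r (ad2_offdiag xPP).
Qed.

Lemma ltriple_scalarV c : exists c', l' (iota' c) = iota c'.
Proof. exact: (ltriple_scalar iotaP' iotaP lP' c GHP). Qed.

Lemma idem_lte e c : a = e + iota c -> exists k, l e = P + iota' k.
Proof.
move=> aE; have [k lk] := ltriple_scalar iotaP iotaP' lP c PQP.
exists (- k); have -> : e = a - iota c by rewrite aE addrK.
by rewrite (ltripleB iotaP iotaP' lP) (ltripleVK lP) lk scalarN.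
Qed.

Lemma ad2_lte x : lie a (lie a x) = x -> l x = P * l x * Q + Q * l x * P.
Proof.
move=> aax; apply: (lie_idem2_corner PQP); rewrite -[in LHS](ltripleVK lP P).
rewrite -(ltriple_lie lP); congr l.
by rewrite lieC [lie x a]lieC lieN opprK.
Qed.

End LieTripleIdempotent.

Lemma lieNl (A : pzRingType) (x y : A) : lie (- x) y = - lie x y.
Proof. by rewrite /lie; nc_ring. Qed.

(* Multiplying n y + y n = 2 (a - 1) y a by a or a - 1 on either side shows that
   n is central. *)
Lemma ad2_idem (K : numFieldType) (A : pzRingType) (iota : K -> A) (G H a : A) :
  peirce iota G H -> (forall y, lie a (lie a y) = lie a y) ->
  let n := a * a - a in
  (forall y, n * y * n = 0) -> n * a = 0 \/ n * (a - 1) = 0 -> n = 0.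
Proof.
move=> GHP a2 n nyn na; have iotaP := peirce_scalars GHP.
have key y : n * y + y * n = (a - 1) * y * a + (a - 1) * y * a.
  have /eqP := a2 y; rewrite -subr_eq0 => /eqP a2y.
  apply/eqP; rewrite -subr_eq0 -a2y /lie /n; apply/eqP; nc_ring.
have an : a * n = n * a by rewrite /n; nc_ring.
have nn : n * n = 0 by have := nyn 1; rewrite mulr1.
suff nC y : n * y = y * n.
  have [c nc] := centre_scalar GHP nC.
  have [c0|c0] := eqVneq c 0; first by rewrite nc c0 scalar0.
  by apply: (scalarI iotaP c0); rewrite -nc.
have A1 : a * n * y + a * y * n = n * y * a + n * y * a.
  have -> : a * n * y + a * y * n = a * (n * y + y * n) by nc_ring.
  by rewrite key /n; nc_ring.
have B1 : n * y * (a - 1) + y * (n * (a - 1)) =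
    (a - 1) * y * n + (a - 1) * y * n.
  have -> : n * y * (a - 1) + y * (n * (a - 1)) = (n * y + y * n) * (a - 1).
    nc_ring.
  by rewrite key /n; nc_ring.
case: na => na.
- have A2 : a * y * n = n * y * a + n * y * a by rewrite -A1 an na mul0r add0r.
  (* Multiply [A2] by a on the right: the left side vanishes, and a^2 = a + n with n y n = 0 leaves
     2 n y a = 0. *)
  have nya : n * y * a = 0.
    apply: (doubler_eq0 iotaP).
    have := congr1 (fun t => t * a) A2; rewrite -mulrA na mulr0.
    move=> /esym; have -> : (n * y * a + n * y * a) * a =
      n * y * a + n * y * a + (n * y * n + n * y * n) by rewrite /n; nc_ring.
    by rewrite nyn !addr0.
  have nE : n * (a - 1) = - n by rewrite mulrBr na mulr1 sub0r.
  move: B1; rewrite nE => B2.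
  have : n * y * a - n * y - y * n =
      a * y * n - y * n + (a * y * n - y * n).
    have <- : (a - 1) * y * n + (a - 1) * y * n = a * y * n - y * n + (a * y * n - y * n).
      nc_ring.
    by rewrite -B2; nc_ring.
  rewrite A2 nya !addr0 !sub0r => e.
  have : n * y - y * n = 0.
    have -> : n * y - y * n = - y * n - y * n - (- (n * y) - y * n) by nc_ring.
    by rewrite e; nc_ring.
  by move=> /eqP; rewrite subr_eq0 => /eqP.
- have n1 : n * a = n by apply/eqP; rewrite -subr_eq0 -{2}[n]mulr1 -mulrBr na.
  move: B1; rewrite na mulr0 addr0 => B2.
  have byn : (a - 1) * y * n = 0.
    have bbyn : (a - 1) * ((a - 1) * y * n) = 0.
      apply: (doubler_eq0 iotaP); rewrite -mulrDr -B2.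
      rewrite !mulrA; have -> : (a - 1) * n = n * (a - 1) by rewrite /n; nc_ring.
      by rewrite na !mul0r.
    have bbE w : (a - 1) * y * w = n * y * w - (a - 1) * ((a - 1) * y * w).
      by rewrite /n; nc_ring.
    by rewrite bbE nyn bbyn subr0.
  move: B2; rewrite byn addr0 mulrBr mulr1 => /eqP; rewrite subr_eq0 => /eqP nya.
  have ayn : a * y * n = y * n.
    by apply/eqP; rewrite -subr_eq0 -{2}[y]mul1r -!mulrBl byn.
  move: A1; rewrite an n1 ayn nya => /eqP.
  by rewrite eq_sym (inj_eq (addrI _)) => /eqP.
Qed.

(* If ad a is idempotent and HAG = 0, comparing both sides of
   ad(a)^2 y = ad(a) y on GAH shows that GaG or HaH is scalar. *)
Lemma ad2_split (K : numFieldType) (A : pzRingType) (iota : K -> A) (G H a : A) :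
  peirce iota G H -> (forall y, H * y * G = 0) ->
  (forall y, lie a (lie a y) = lie a y) ->
  exists c e, e * e = e /\ a = e + iota c.
Proof.
move=> GHP HG0 a2; have iotaP := peirce_scalars GHP.
have xG x : x * G = G * x * G.
  by rewrite -[LHS]mul1r -(peirce_sum GHP) mulrDl !mulrA HG0 addr0.
have Hx x : H * x = H * x * H.
  by rewrite -[LHS]mulr1 -(peirce_sum GHP) mulrDr HG0 add0r.
have shift c y : lie (a - iota c) y = lie a y.
  by rewrite lieDl lieNl lie_scalar// oppr0 addr0.
have conclude c : let a1 := a - iota c in let n := a1 * a1 - a1 in
    n = G * n * H -> n * a1 = 0 \/ n * (a1 - 1) = 0 -> a1 * a1 = a1.
  move=> a1 n nE na; apply/eqP; rewrite -subr_eq0; apply/eqP.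
  apply: (ad2_idem GHP) => // [y|y]; rewrite -?/n.
    by rewrite !shift a2.
  rewrite nE; have -> : G * n * H * y * (G * n * H) = G * n * (H * y * G) * (n * H).
    by nc_ring.
  by rewrite HG0 mulr0 mul0r.
have Gy y : corner G H y -> a * y = G * a * G * y.
  by move=> [Gy _]; rewrite -{1}Gy mulrA xG.
have yH y : corner G H y -> y * a = y * (H * a * H).
  by move=> [_ e]; rewrite -Hx mulrA e.
have LG := cornerEE GHP a; have RH := cornerFF GHP a.
move: LG RH Gy yH; move LE: (G * a * G) => L; move RE: (H * a * H) => R LG RH Gy yH.
(* On GAH, ad(a) is y -> Ly - yR, so ad(a)^2 = ad(a) reads 2 LyR = (L^2 - L) y + y (R^2 + R). *)
have := peirce_tensor GHP LG RH (c := iota 2^-1 * (L * L - L))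
  (d := iota 2^-1 * (R * R + R)).
case.
- by apply: corner_scale => //; apply: corner_sub => //; exact: (cornerM LG LG).
- by apply: corner_scale => //; apply: corner_add => //; exact: (cornerM RH RH).
- move=> y yGH; have ay : lie a y = L * y - y * R by rewrite /lie Gy ?yH.
  have wGH : corner G H (L * y - y * R).
    by apply: corner_sub; [exact: (cornerM LG yGH)|exact: (cornerM yGH RH)].
  have := a2 y; rewrite ay /lie (Gy _ wGH) (yH _ wGH) => /eqP.
  rewrite -subr_eq0 => /eqP e.
  rewrite (mulrA y) -(scalarC iotaP) -!mulrA -mulrDr.
  rewrite -[LHS]mul1r -(scalar_half iotaP) mulrDl -mulrDr; congr (_ * _).
  apply/eqP; rewrite -subr_eq0 -[X in _ == X]oppr0 -e; apply/eqP; nc_ring.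
(* Shifting by k - 1 makes a1 the identity on G, the case where the idempotent dominates G. Then
   a1^2 - a1 lies in GAH and is killed by a1 - 1. *)
- move=> [k Lk]; exists (k - 1), (a - iota (k - 1)); rewrite subrK; split=> //.
  set a1 := a - _.
  have a1G : a1 * G = G.
    rewrite mulrBl xG LE Lk scalarD// scalarN// scalar1//; nc_ring.
  have nG : (a1 * a1 - a1) * G = 0 by rewrite mulrBl -mulrA !a1G subrr.
  have HnH : H * (a1 * a1 - a1) * H = 0.
    apply: (faithfulr GHP) => [|y [Gy' yH']]; first exact: cornerFF GHP _.
    have a1y : a1 * y = y by rewrite -Gy' mulrA a1G.
    have := a2 y; rewrite -!(shift (k - 1)) -/a1 /lie a1y mulrBr mulrA a1y => e.
    rewrite -Hx mulrA yH'.
    have -> : y * (a1 * a1 - a1) = y - y * a1 - (y - y * a1) * a1 - (y - y * a1).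
      by nc_ring.
    by rewrite e subrr.
  have nE : a1 * a1 - a1 = G * (a1 * a1 - a1) * H.
    rewrite {1}(peirce_decomp GHP (a1 * a1 - a1)) HnH -!(mulrA _ _ G) nG !mulr0.
    by rewrite add0r !addr0.
  apply: (conclude (k - 1)); rewrite -/a1 //.
  right; have -> : (a1 * a1 - a1) * (a1 - 1) = (a1 - 1) * (a1 * a1 - a1) by nc_ring.
  by rewrite nE !mulrA mulrBl a1G mul1r subrr !mul0r.
(* Shifting by k gives H a1 = 0, the case of an idempotent with range below G; now a1^2 - a1 lies in
   GAH and is killed by a1 on the right. *)
- move=> [k Rk]; exists k, (a - iota k); rewrite subrK; split=> //.
  set a1 := a - _.
  have Ha1 : H * a1 = 0.
    by rewrite mulrBr Hx RE Rk scalarC// subrr.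
  have Hn : H * (a1 * a1 - a1) = 0 by rewrite mulrBr mulrA Ha1 mul0r subrr.
  have GnG : G * (a1 * a1 - a1) * G = 0.
    apply: (faithfull GHP) => [|y yGH]; first exact: cornerEE GHP _.
    have ya1 : y * a1 = 0 by case: yGH => _ <-; rewrite -mulrA Ha1 mulr0.
    have := a2 y; rewrite -!(shift k) -/a1 /lie ya1 subr0 -mulrA ya1 mulr0 subr0 => e.
    by rewrite -xG -mulrA (proj1 yGH) mulrBl -mulrA e subrr.
  have nE : a1 * a1 - a1 = G * (a1 * a1 - a1) * H.
    rewrite {1}(peirce_decomp GHP (a1 * a1 - a1)) GnG Hn !mul0r.
    by rewrite add0r !addr0.
  apply: (conclude k); rewrite -/a1 //.
  by left; rewrite nE -mulrA Ha1 mulr0.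
Qed.

(** * Eigenspaces of ad(a) when QA'P = 0 *)

Section TriangularTarget.
Variables (K : numFieldType) (A A' : pzRingType).
Variables (iota : K -> A) (iota' : K -> A') (G H : A) (P Q : A').
Variables (l : A -> A') (l' : A' -> A).
Hypothesis lP : lie_triple_equiv iota iota' l l'.
Hypothesis GHP : peirce iota G H.
Hypothesis PQP : peirce iota' P Q.
Hypothesis QP0 : forall y, Q * y * P = 0.
Let iotaP := peirce_scalars GHP.
Let iotaP' := peirce_scalars PQP.
Local Notation a := (l' P).
Let a3 := ad3 lP GHP PQP.

Let scale2 (A0 : pzRingType) (kappa : K -> A0) (x : A0) :
  scalars kappa -> kappa 2 * x = x + x.
Proof. by move=> kP; rewrite scalar_nat// mulr_natl mulr2n. Qed.

Let cube2 : (2 : K) ^+ 3 != 2.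
Proof. by rewrite -natrX eqr_nat. Qed.

Let cubeN2 : (- 2 : K) ^+ 3 != - 2.
Proof. by rewrite !exprS expr0 mulr1 mulNr mulrNN eqr_opp -natrM -natrM eqr_nat. Qed.

Lemma pos_mul0 x y : lie a x = x -> lie a y = y -> x * y = 0.
Proof.
move=> ax ay; apply: (ad3_eigen iotaP a3 _ cube2).
by rewrite lieMr ax ay scale2.
Qed.

Lemma neg_mul0 x y : lie a x = - x -> lie a y = - y -> x * y = 0.
Proof.
move=> ax ay; apply: (ad3_eigen iotaP a3 _ cubeN2).
have -> : iota (- 2) * (x * y) = - (iota 2 * (x * y)) by rewrite scalarN// mulNr.
by rewrite lieMr ax ay scale2//; nc_ring.
Qed.

Lemma pos_corner x : lie a x = x -> corner P Q (l x).
Proof.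
move=> ax; rewrite (ad2_lte lP PQP (x := x)) ?ax// QP0 addr0.
exact: (cornerEF PQP).
Qed.

Lemma neg_corner x : lie a x = - x -> corner P Q (l x).
Proof.
move=> ax; rewrite (ad2_lte lP PQP (x := x)) ?ax ?lieN ?ax ?opprK// QP0 addr0.
exact: (cornerEF PQP).
Qed.

(** Products inside PA'Q vanish, so l(x) and l(y) commute and all second commutators starting from
    [x, y] are zero. *)
Lemma corner_lie0 x y : corner P Q (l x) -> corner P Q (l y) ->
  exists c, lie x y = iota c.
Proof.
move=> xPQ yPQ; apply: (centre_scalar GHP) => w; apply/lie_eq0.
apply: (ltripleI lP); rewrite (ltriple_lie lP) (ltriple0 iotaP iotaP' lP).
rewrite {2}/lie (corner_mul0' PQP xPQ yPQ) (corner_mul0' PQP yPQ xPQ).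
by rewrite subr0 lie0l.
Qed.

(** Both images lie in PA'Q, so [x, y] is a scalar c; since x^2 = 0, 2cx = [x^2, y] = 0. *)
Lemma pos_neg_comm x y : lie a x = x -> lie a y = - y -> x * y = y * x.
Proof.
move=> ax ay; apply/lie_eq0.
have [c xy] := corner_lie0 (pos_corner ax) (neg_corner ay).
have xx := pos_mul0 ax ax.
have cx : iota c * x + iota c * x = 0.
  rewrite -{1}xy {1}/lie (scalarC iotaP) -xy /lie mulrBr mulrBl !mulrA xx.
  by rewrite -(mulrA y) xx mul0r mulr0 subr0 sub0r subrr.
have [c0|c0] := eqVneq c 0; first by rewrite xy c0 scalar0.
by rewrite (scalarI iotaP c0 (doubler_eq0 iotaP cx)) lie0l.
Qed.

(* z = x y commutes with a and with l'(PA'Q), so l z is a scalar; as z^2 = 0 it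
   vanishes. *)
Lemma pos_neg_mul0 x y : lie a x = x -> lie a y = - y -> x * y = 0.
Proof.
move=> ax ay; have xyC := pos_neg_comm ax ay; set z := x * y.
have az : lie a z = 0 by rewrite lieMr ax ay mulrN subrr.
have Plz : P * l z = l z * P.
  apply/lie_eq0; rewrite -(lie_idem3 _ (peirce_idem PQP)).
  have PzC w : lie (lie P (l z)) w = 0.
    rewrite -{1}[P](ltripleVK lP) -[w](ltripleVK lP) -(ltriple_lie lP) az lie0l.
    exact: ltriple0 iotaP iotaP' lP.
  by rewrite [lie P (lie P (l z))]lieC PzC oppr0 lie0.
have zX u : lie a (lie a u) = u -> lie z u = 0.
  move=> aau; set v := lie a u.
  have av : lie a v = u by [].
  have uvP : lie a (u + v) = u + v by rewrite lieD av -/v addrC.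
  have uvN : lie a (u - v) = - (u - v) by rewrite lieD lieN av -/v opprB addrC.
  have z_pos : lie z (u + v) = 0.
    rewrite /lie /z mulrA -(mulrA x) -(pos_neg_comm uvP ay) mulrA (pos_mul0 ax uvP).
    by rewrite (pos_mul0 uvP ax) !mul0r subrr.
  have z_neg : lie z (u - v) = 0.
    rewrite /lie /z -(mulrA x) (neg_mul0 ay uvN) mulrA -(pos_neg_comm ax uvN).
    by rewrite -(mulrA x) (neg_mul0 uvN ay) !mulr0 subrr.
  apply: (doubler_eq0 iotaP); rewrite -lieD.
  have -> : u + u = (u + v) + (u - v) by nc_ring.
  by rewrite lieD z_pos z_neg addr0.
have lzC : exists k, l z = iota' k.
  have Qlz := comm_peirceF PQP Plz.
  have [w wPQ|k [zP zQ]] := peirce_balanced PQP (cornerEE PQP (l z)) (cornerFF PQP (l z)).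
    have [Pw wQ] := wPQ.
    have [c] : exists c, lie (l z) w = iota' c.
      apply: (centre_scalar PQP) => t; apply/lie_eq0.
      rewrite -[w](ltripleVK lP) -[t](ltripleVK lP) -(ltriple_lie lP).
      rewrite zX ?lie0l ?(ltriple0 iotaP iotaP' lP)//; apply: (ad2_offdiag lP).
      by rewrite (lie_cornerEF PQP wPQ) lieNl (lie_cornerEF PQP wPQ) opprK.
    have := corner_lieEF PQP Plz wPQ; move=> zwPQ zwE.
    have zw0 : lie (l z) w = 0.
      have [Pc cQ] := zwPQ; rewrite -cQ -Pc zwE -(scalarC iotaP') -mulrA.
      by rewrite (peirceEF PQP) mulr0.
    rewrite Plz -(mulrA _ P w) Pw -(mulrA _ P w) Pw !mulrA wQ -(mulrA w) -Qlz mulrA wQ.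
    by apply/lie_eq0.
  exists k; rewrite (peirce_decomp PQP (l z)) zP zQ.
  have [-> ->] := commE PQP Plz.
  by rewrite addr0 add0r -mulrDr (peirce_sum PQP) mulr1.
have [k lz] := lzC; have [c zc] := ltriple_scalarV lP GHP PQP k.
have {}zc : z = iota c by rewrite -zc -lz (ltripleK lP).
have [c0|c0] := eqVneq c 0; first by rewrite zc c0 scalar0.
apply: (scalarI iotaP c0); rewrite -zc /z -mulrA (mulrA y) -xyC -!mulrA.
by rewrite (neg_mul0 ay ay) !mulr0.
Qed.

(** The witnesses are the spectral projections (t^2 + t)/2 and (t^2 - t)/2 of an operator with t^3 =
    t, applied to y. *)
Lemma ad_parts y : exists u v, [/\ lie a y = u - v, lie a u = u & lie a v = - v].
Proof.
pose h := iota 2^-1; pose w := lie a y; pose w' := lie a w.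
have aw' : lie a w' = w by exact: a3.
exists (h * (w' + w)), (h * (w' - w)); split.
- have -> : h * (w' + w) - h * (w' - w) = (h + h) * w by nc_ring.
  by rewrite scalar_half// mul1r.
- rewrite (lie_iota iotaP) lieD aw' -/w' -/h; nc_ring.
- rewrite (lie_iota iotaP) lieD lieN aw' -/w' -/h; nc_ring.
Qed.

(** In [a, yx] = [a, y]x + yx the first term vanishes: [a, y] is a difference of eigenvectors for 1
    and -1, and x annihilates both kinds. *)
Lemma pos_ideal x y : lie a x = x -> lie a (y * x) = y * x /\ lie a (x * y) = x * y.
Proof.
move=> ax; have [u [v [ay au av]]] := ad_parts y.
rewrite !lieMr ay ax mulrBl mulrBr (pos_mul0 au ax) (pos_mul0 ax au).
rewrite (pos_neg_mul0 ax av) -(pos_neg_comm ax av) (pos_neg_mul0 ax av).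
by rewrite !subrr add0r addr0.
Qed.

Lemma neg_ideal x y :
  lie a x = - x -> lie a (y * x) = - (y * x) /\ lie a (x * y) = - (x * y).
Proof.
move=> ax; have [u [v [ay au av]]] := ad_parts y.
rewrite !lieMr ay ax mulrBl mulrBr (neg_mul0 av ax) (neg_mul0 ax av).
rewrite (pos_neg_mul0 au ax) -(pos_neg_comm au ax) (pos_neg_mul0 au ax).
by rewrite !subrr add0r addr0 mulrN mulNr.
Qed.

(** A nonzero element common to the ideals generated by x and y would be an eigenvector for both 1
    and -1. *)
Lemma pos_or_neg :
  (forall x y : A, x <> 0 -> y <> 0 ->
    exists r s r' s', r * x * s = r' * y * s' /\ r * x * s <> 0) ->
  (forall x, lie a x = x -> x = 0) \/ (forall x, lie a x = - x -> x = 0).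
Proof.
move=> meet; have [|/existsNP[x /not_implyP[ax x0]]] :=
  pselect (forall x, lie a x = x -> x = 0); [by left|right=> y ay].
apply: contrapT => y0; have [r [s [r' [s' [xyE]]]]] := meet x y x0 y0; apply.
have := (neg_ideal s' (neg_ideal r' ay).1).2; rewrite -xyE.
rewrite (pos_ideal s (pos_ideal r ax).1).2 => zz.
by apply: (doubler_eq0 iotaP); rewrite {1}zz addNr.
Qed.

Lemma ad2_pos : (forall x, lie a x = - x -> x = 0) ->
  forall y, lie a (lie a y) = lie a y.
Proof.
move=> a0 y.
have /a0 : lie a (lie a (lie a y) - lie a y) = - (lie a (lie a y) - lie a y).
  by rewrite [LHS]lieD lieN a3 [RHS]opprB.
by move=> /eqP; rewrite subr_eq0 => /eqP.
Qed.

(** Split y into eigenvectors for 0 and 1; then x y x has parts of eigenvalue 2 and 3, which ad(b)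
    does not admit. *)
Lemma ad2_square0 (b x : A) : (forall y, lie b (lie b y) = lie b y) ->
  lie b x = x -> forall y, x * y * x = 0.
Proof.
move=> b2 bx y; have b3 z : lie b (lie b (lie b z)) = lie b z by rewrite !b2.
have -> : y = (y - lie b y) + lie b y by rewrite subrK.
rewrite mulrDr mulrDl (@ad3_eigen _ _ _ iotaP b (x * (y - lie b y) * x) 2)//.
  rewrite add0r (@ad3_eigen _ _ _ iotaP b (x * lie b y * x) 3)//.
    rewrite !lieMr bx b2 scalar_nat// !mulrSr mulr0n add0r; nc_ring.
  by rewrite -natrX eqr_nat.
rewrite !lieMr bx lieD lieN b2 subrr mulr0 addr0 scale2//.
Qed.

(** Each [b, y] is fixed by ad(b), hence sandwiches every element to 0. This excludes B(H) as the
    source of a nontrivial nest algebra. *)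
Lemma ad2_not_prime (b : A) : (forall y, lie b (lie b y) = lie b y) ->
  (forall x : A, (forall y, x * y * x = 0) -> x = 0) -> exists c, b = iota c.
Proof.
move=> b2 prime; apply: (centre_scalar GHP) => y; apply/lie_eq0/prime.
by apply: ad2_square0 => //; exact: b2.
Qed.

End TriangularTarget.

Lemma pl_triangular (K : numFieldType) (A A' : pzRingType)
    (iota : K -> A) (iota' : K -> A') (E F : A) (P Q : A')
    (l : A -> A') (l' : A' -> A) c :
  lie_triple_equiv iota iota' l l' ->
  peirce iota E F -> peirce iota' P Q ->
  (forall y, F * y * E = 0) -> (forall y, Q * y * P = 0) ->
  l' P = E + iota c -> peirce_lie iota iota' E F P Q l l'.
Proof.
move=> lP EFP PQP FE0 QP0 l'P; have iotaP := peirce_scalars EFP.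
have iotaP' := peirce_scalars PQP.
split=> //; first exact: (idem_lte lP EFP PQP l'P).
  move=> x xEF; apply: (pos_corner lP PQP QP0).
  by rewrite l'P lieDl lie_scalar// addr0 lieC (lie_cornerEF EFP xEF) opprK.
move=> x [Fx xE]; have -> : x = 0 by rewrite -Fx -xE mulrA FE0.
by rewrite (ltriple0 iotaP iotaP' lP); split; rewrite (mulr0, mul0r).
Qed.

Lemma ltripleNeg (K : numFieldType) (A A' : pzRingType)
    (iota : K -> A) (iota' : K -> A') (l : A -> A') (l' : A' -> A) :
  lie_triple_equiv iota iota' l l' ->
  lie_triple_equiv iota iota' (fun x => - l x) (fun y => l' (- y)).
Proof.
move=> lP; split.
- by move=> k x y; rewrite (ltriple_lin lP) opprD mulrN.
- by move=> x; rewrite opprK (ltripleK lP).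
- by move=> x; rewrite (ltripleVK lP) opprK.
- by move=> x y z; rewrite (ltriple_lie lP) /lie; nc_ring.
Qed.

Section TriangularStandard.
Variables (K : numFieldType) (A A' : pzRingType).
Variables (iota : K -> A) (iota' : K -> A') (G H : A) (P Q : A').
Variables (l : A -> A') (l' : A' -> A).
Hypothesis lP : lie_triple_equiv iota iota' l l'.
Hypothesis GHP : peirce iota G H.
Hypothesis PQP : peirce iota' P Q.
Let iotaP := peirce_scalars GHP.
Let iotaP' := peirce_scalars PQP.

Lemma preimage_not_scalar c : l' P <> iota c.
Proof.
move=> l'P; have [k lk] := ltriple_scalar iotaP iotaP' lP c PQP.
have PE : P = iota' k by rewrite -lk -l'P (ltripleVK lP).
have [k0|k0] := eqVneq k 0.
  by apply: (peirce_neq0l PQP); rewrite PE k0 scalar0.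
apply: (peirce_neq0r PQP); apply: (scalarI iotaP' k0).
by rewrite -PE (peirceEF PQP).
Qed.

Hypothesis QP0 : forall y, Q * y * P = 0.

Lemma not_prime_pos : (forall x, lie (l' P) x = - x -> x = 0) ->
  ~ (forall x : A, (forall y, x * y * x = 0) -> x = 0).
Proof.
move=> a0 prime; have [c] := ad2_not_prime GHP (ad2_pos lP GHP PQP a0) prime.
exact: preimage_not_scalar.
Qed.

(** The absence of eigenvectors for -1 is what makes e triangular: (1 - e) y e would be one. *)
Lemma lie_standard_pos :
  (forall y, H * y * G = 0) ->
  (forall E : A, E * E = E -> E <> 0 -> E <> 1 ->
    (forall y, (1 - E) * y * E = 0) -> peirce iota E (1 - E)) ->
  (forall x, lie (l' P) x = - x -> x = 0) -> lie_standard iota iota' l.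
Proof.
move=> HG0 peirceE a0.
have [c [e [ee aE]]] := ad2_split GHP HG0 (ad2_pos lP GHP PQP a0).
have e0 : e <> 0.
  by move=> e0; apply: (@preimage_not_scalar c); rewrite aE e0 add0r.
have e1 : e <> 1.
  move=> e1; apply: (@preimage_not_scalar (1 + c)).
  by rewrite aE e1 scalarD// scalar1.
have FE0 y : (1 - e) * y * e = 0.
  apply: a0; rewrite aE lieDl lie_scalar// addr0 /lie.
  by rewrite mulrBl mul1r !mulrBl !mulrBr !mulrA ee -!mulrA ee; nc_ring.
exact: (peirce_lie_standard (pl_triangular lP (peirceE e ee e0 e1 FE0) PQP FE0 QP0 aE)).
Qed.

End TriangularStandard.

(** Complete the square: b = a - al/2 has scalar square ga, so ad(b)^3 = 4 ga ad(b). As a is not a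
    scalar, 4 ga = 1, and b + 1/2 is idempotent. *)
Lemma quadratic_idem (K : numFieldType) (A : pzRingType) (iota : K -> A) (a : A) al be :
  scalars iota -> (forall z, (forall x, z * x = x * z) -> exists k, z = iota k) ->
  (forall y, lie a (lie a (lie a y)) = lie a y) -> (forall k, a <> iota k) ->
  a * a = iota al * a + iota be -> exists e c, e * e = e /\ a = e + iota c.
Proof.
move=> iotaP centre a3 aS aa; pose c := 2^-1 * al; pose b := a - iota c.
pose ga := be + c * c.
have cc : iota c + iota c = iota al.
  by rewrite scalarM// -mulrDl scalar_half// mul1r.
have cC x : x * iota c = iota c * x by rewrite (scalarC iotaP).
have bb : b * b = iota ga.
  have -> : b * b = a * a - a * iota c - iota c * a + iota c * iota c.
    by rewrite /b; nc_ring.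
  rewrite aa (cC a) -cc /ga (scalarD iotaP be) (scalarM iotaP c c); nc_ring.
have ab x : lie a x = lie b x.
  by rewrite [RHS]lieDl lieNl lie_scalar// oppr0 addr0.
have gC x : x * iota ga = iota ga * x by rewrite (scalarC iotaP).
have b3 y : iota (ga + ga + (ga + ga) - 1) * lie b y = 0.
  have /eqP := a3 y; rewrite !ab -subr_eq0 => /eqP <-.
  have -> : lie b (lie b (lie b y)) = b * b * (b * y) - b * b * (y * b) -
      (b * b * (y * b) + b * b * (y * b)) + (b * y * (b * b) + b * y * (b * b)) +
      b * y * (b * b) - y * b * (b * b).
    by rewrite /lie; nc_ring.
  rewrite bb (gC (b * y)) (gC (y * b)) /lie.
  rewrite !(scalarD iotaP (ga + ga), scalarD iotaP ga, scalarD iotaP (_ + _)).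
  by rewrite scalarN// scalar1//; nc_ring.
have g4 : ga + ga + (ga + ga) - 1 = 0.
  apply: contrapT => /eqP g4; have [k ak] : exists k, a = iota k.
    by apply: centre => x; apply/lie_eq0; rewrite ab; exact: (scalarI iotaP g4 (b3 x)).
  exact: aS ak.
have hK : 2^-1 + 2^-1 = 1 :> K by rewrite [RHS]splitr div1r.
have gaE : ga = 2^-1 * 2^-1.
  have -> : ga = (2^-1 + 2^-1) * (2^-1 + 2^-1) * ga by rewrite hK !mul1r.
  have -> : (2^-1 + 2^-1) * (2^-1 + 2^-1) * ga =
    2^-1 * 2^-1 * (ga + ga + (ga + ga) - 1) + 2^-1 * 2^-1 by nc_ring.
  by rewrite g4 mulr0 add0r.
pose h := iota 2^-1.
have hC : b * h = h * b by rewrite /h (scalarC iotaP).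
exists (b + h), (c - 2^-1); split.
  have -> : (b + h) * (b + h) = b * b + b * h + h * b + h * h by nc_ring.
  rewrite bb hC gaE scalarM// -/h.
  have -> : h * h + h * b + h * b + h * h = (h + h) * (b + h) by nc_ring.
  by rewrite scalar_half// mul1r.
by rewrite scalarD// scalarN// /b -/h; nc_ring.
Qed.

(** For x in EAF or FAE, l(x) = u + v with u in PA'Q and v in QA'P, and [[E, x], x] = 0 yields uv =
    vu. These products lie in different diagonal corners, so both are 0, and minimality of P kills u
    or v. *)
Lemma pl_minimal (K : numFieldType) (A A' : pzRingType)
    (iota : K -> A) (iota' : K -> A') (E F : A) (P Q : A')
    (l : A -> A') (l' : A' -> A) c :
  lie_triple_equiv iota iota' l l' ->
  peirce iota E F -> peirce iota' P Q -> peirce iota' Q P -> l' P = E + iota c ->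
  (forall u v, corner P Q u -> corner Q P v -> v * u = 0 -> u = 0 \/ v = 0) ->
  lie_standard iota iota' l.
Proof.
move=> lP EFP PQP QPP l'P minP.
have iotaP := peirce_scalars EFP; have iotaP' := peirce_scalars PQP.
have lB := ltripleB iotaP iotaP' lP; have lD := ltripleD iotaP iotaP' lP.
have lE := idem_lte lP EFP PQP l'P.
have aE x : lie (l' P) x = lie E x by rewrite l'P lieDl lie_scalar// addr0.
have offdiag x : lie E (lie E x) = x -> lie (lie E x) x = 0 ->
    corner P Q (l x) \/ corner Q P (l x).
  rewrite -!aE => aax axx; have lx := ad2_lte lP PQP aax.
  set u := P * l x * Q in lx; set v := Q * l x * P in lx.
  have uPQ : corner P Q u by exact: cornerEF PQP _.
  have vQP : corner Q P v by exact: cornerFE PQP _.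
  have uP := lie_cornerEF PQP uPQ; have vP := lie_cornerFE PQP vQP.
  have Puv : lie P (l x) = u - v by rewrite lx lieD lieC uP opprK lieC vP.
  have := ltriple_lie lP (l' P) x x.
  rewrite (ltripleVK lP) Puv axx (ltriple0 iotaP iotaP' lP).
  rewrite {1}lx => uv0.
  have uv : u * v = v * u.
    apply/eqP; rewrite -subr_eq0; apply/eqP. apply: (doubler_eq0 iotaP').
    by rewrite [RHS]uv0 /lie; nc_ring.
  have vu0 : v * u = 0.
    by rewrite -uv -uPQ.1 -mulrA uv mulrA -vQP.1 mulrA (peirceEF PQP) !mul0r.
  have [u0|v0] := minP u v uPQ vQP vu0.
    by right; rewrite lx u0 add0r.
  by left; rewrite lx v0 addr0.
have corner_lB X Y x y : corner X Y (l x) -> corner X Y (l y) -> corner X Y (l (x - y)).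
  by rewrite lB; exact: corner_sub.
have EFalt : (forall x, corner E F x -> corner P Q (l x)) \/
             (forall x, corner E F x -> corner Q P (l x)).
  apply: additive_union => [x y|x y|x y|x xEF];
    [exact: corner_add|exact: corner_lB|exact: corner_lB|].
  have Ex : lie E x = x by rewrite lieC (lie_cornerEF EFP xEF) opprK.
  by apply: offdiag; rewrite ?Ex// /lie subrr.
have FEalt : (forall x, corner F E x -> corner P Q (l x)) \/
             (forall x, corner F E x -> corner Q P (l x)).
  apply: additive_union => [x y|x y|x y|x xFE];
    [exact: corner_add|exact: corner_lB|exact: corner_lB|].
  have Ex : lie E x = - x by rewrite lieC (lie_cornerFE EFP xFE).
  by apply: offdiag; rewrite ?Ex ?lieN ?Ex ?opprK// /lie; nc_ring.
have onto X Y : (forall x, corner E F x -> corner X Y (l x)) ->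
    (forall x, corner F E x -> corner X Y (l x)) ->
    forall y, lie (lie y P) P = y -> corner X Y y.
  move=> EFXY FEXY y yPP; have := ad2_offdiag lP yPP; rewrite !aE => yEE.
  have yE : l' y = E * l' y * F + F * l' y * E.
    by apply: (lie_idem2_corner EFP); rewrite lieC [lie (l' y) E]lieC lieN opprK.
  rewrite -[y](ltripleVK lP) yE lD; apply: corner_add.
    by apply: EFXY; exact: cornerEF EFP _.
  by apply: FEXY; exact: cornerFE EFP _.
have PQPP y : corner P Q y -> lie (lie y P) P = y.
  by move=> yPQ; rewrite (lie_cornerEF PQP yPQ) lieNl (lie_cornerEF PQP yPQ) opprK.
have QPPP y : corner Q P y -> lie (lie y P) P = y.
  by move=> yQP; rewrite !(lie_cornerFE PQP yQP).
have [EFPQ|EFQP] := EFalt; have [FEPQ|FEQP] := FEalt.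
(* If both corners went to PA'Q, all off-diagonal elements would lie there; QA'P would be 0 and
   faithfulness would force Q = 0. *)
- case: (peirce_neq0l QPP); apply: (faithfull QPP).
    by split; exact: peirce_idem QPP.
  move=> y yQP; have [_ _] := yQP; rewrite yQP.1.
  by apply: (corner_disjoint PQP) => //; apply: (onto _ _ EFPQ FEPQ); exact: QPPP.
- by apply: (@peirce_lie_standard _ _ _ _ _ E F P Q l l').
- apply: (lie_standard_neg iotaP').
  apply: (@peirce_lie_standard _ _ _ _ _ E F Q P _ (fun y => l' (- y))).
  split=> //; first exact: ltripleNeg.
  + have [k lEk] := lE; exists (- 1 - k).
    by rewrite lEk scalarD// !scalarN// scalar1// (peirceF PQP); nc_ring.
  + by move=> x /EFQP[Qx xP]; split; rewrite (mulrN, mulNr) ?Qx ?xP.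
  + by move=> x /FEPQ[Qx xP]; split; rewrite (mulrN, mulNr) ?Qx ?xP.
- case: (peirce_neq0l PQP); apply: (faithfull PQP).
    by split; exact: peirce_idem PQP.
  move=> y yPQ; rewrite yPQ.1.
  by apply: (corner_disjoint PQP) => //; apply: (onto _ _ EFQP FEQP); exact: PQPP.
Qed.

(** * Hilbert spaces and rank-one operators *)

Section Hilbert.
Local Open Scope classical_set_scope.
Local Open Scope complex_scope.
Local Open Scope ring_scope.
Variables (R : realType) (H : hilbertType R).
Implicit Types (x y z u v g h : H) (a : R[i]).

Lemma innerDl x y z : inner (x + y) z = inner x z + inner y z.
Proof. exact: linearDl. Qed.
Lemma innerDr x y z : inner x (y + z) = inner x y + inner x z.
Proof. exact: linearDr. Qed.
Lemma innerNl x y : inner (- x) y = - inner x y.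
Proof. exact: linearNl. Qed.
Lemma innerNr x y : inner x (- y) = - inner x y.
Proof. exact: linearNr. Qed.
Lemma innerZl a x y : inner (a *: x) y = a * inner x y.
Proof. exact: linearZl_LR. Qed.
Lemma innerC x y : inner y x = (inner x y)^*.
Proof. by rewrite (hermC inner) expr0 mul1r. Qed.
Lemma innerZr a x y : inner x (a *: y) = a^* * inner x y.
Proof. by rewrite innerC innerZl rmorphM [inner x y]innerC. Qed.
Lemma inner0l x : inner 0 x = 0. Proof. exact: linear0l. Qed.
Lemma inner0r x : inner x 0 = 0. Proof. exact: linear0r. Qed.

Lemma inner_eq0 x : inner x x = 0 -> x = 0.
Proof. by rewrite -inner_norm => /eqP; rewrite expf_eq0/= normr_eq0 => /eqP. Qed.

(** Serves twice: positivity of the left side gives the Cauchy-Schwarz inequality, and its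
    minimality makes near-minimisers of a distance nearly orthogonal. *)
Lemma inner_sub_proj x y : y != 0 ->
  `|x - (inner x y / `|y| ^+ 2) *: y| ^+ 2 = `|x| ^+ 2 - `|inner x y| ^+ 2 / `|y| ^+ 2.
Proof.
move=> y0; set t := _ / _.
have yy0 : `|y| ^+ 2 != 0 by rewrite expf_eq0/= normr_eq0.
have ty : t * inner y y = inner x y by rewrite -inner_norm divfK.
have wy : inner (x - t *: y) y = 0 by rewrite innerDl innerNl innerZl ty subrr.
rewrite inner_norm innerDr innerNr innerZr wy mulr0 subr0 innerDl innerNl innerZl.
by rewrite -inner_norm /t [inner y x]innerC normCK mulrAC.
Qed.

Lemma inner_CS x y : `|inner x y| <= `|x| * `|y|.
Proof.
have [->|y0] := eqVneq y 0; first by rewrite inner0r !normr0 mulr0.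
have : 0 <= `|x - (inner x y / `|y| ^+ 2) *: y| ^+ 2 by rewrite exprn_ge0.
rewrite inner_sub_proj// subr_ge0 ler_pdivrMr ?exprn_gt0 ?normr_gt0//.
by rewrite -exprMn ler_pXn2r// nnegrE mulr_ge0.
Qed.

Lemma parallelogram x y : `|x + y| ^+ 2 + `|x - y| ^+ 2 =
  (`|x| ^+ 2 + `|y| ^+ 2) + (`|x| ^+ 2 + `|y| ^+ 2).
Proof.
rewrite !inner_norm !innerDl !innerDr !innerNl !innerNr; nc_ring.
Qed.

Definition rank1 u g : H -> H := fun h => inner h g *: u.

Lemma rank1_bounded u g : bounded_operator (rank1 u g).
Proof.
split; first by move=> a x y; rewrite /rank1 innerDl innerZl scalerDl scalerA.
exists (complex.Re (`|g| * `|u|)) => x; rewrite RRe_real ?ger0_real ?mulr_ge0//.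
by rewrite /rank1 normrZ mulrAC ler_wpM2r// mulrC inner_CS.
Qed.

Lemma norm_real x : (complex.Re `|x|)%:C = `|x|.
Proof. by rewrite RRe_real// ger0_real. Qed.

(** The point is the limit of the filter generated by the sets of near-minimisers, which is Cauchy
    by the parallelogram law. Orthogonality is proved approximately for near-minimisers and passed
    to the limit. *)
Lemma closed_proj (X : set H) x : linear_subspace X -> closed X ->
  exists2 y, X y & forall m, X m -> inner (x - y) m = 0.
Proof.
move=> [X0 XL] Xc.
have XD u v : X u -> X v -> X (u + v) by move=> *; rewrite -[u]scale1r; exact: XL.
have XZ a u : X u -> X (a *: u) by move=> *; rewrite -[_ *: _]addr0; exact: XL.
(* Norms take values in R[i]; infima need real numbers. *)
pose sq u : R := complex.Re (`|u| ^+ 2).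
have sqE u : (sq u)%:C = `|u| ^+ 2 by rewrite RRe_real// ger0_real// exprn_ge0.
pose S := [set sq (x - y) | y in X].
have Sinf : has_inf S.
  split; first by exists (sq (x - 0)), 0.
  by exists 0 => _ [y _ <-]; rewrite -lecR sqE exprn_ge0.
pose D := inf S.
have DP y : X y -> D <= sq (x - y) by move=> Xy; apply: (ge_inf Sinf.2); exists y.
pose B (e : R) := [set y | X y /\ sq (x - y) < D + e].
have B0 e : 0 < e -> B e !=set0.
  by move=> e0; have [_ [y Xy <-] yD] := inf_adherent e0 Sinf; exists y.
pose F := filter_from [set e : R | 0 < e] B.
have FF : ProperFilter F.
  apply: filter_from_proper; last by move=> e; exact: B0.
  apply: filter_from_filter; first by exists 1 => /=.
  move=> e f /= e0 f0; exists (Num.min e f); first by rewrite /= lt_min e0.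
  move=> y [Xy yD]; split; split => //; apply: lt_le_trans yD _.
    by rewrite lerD2l ge_min lexx.
  by rewrite lerD2l ge_min lexx orbT.
have par u v : sq (u + v) + sq (u - v) = (sq u + sq v) + (sq u + sq v).
  by apply: complexI; rewrite !rmorphD/= !sqE parallelogram.
have sq2 u : sq (u + u) = 4 * sq u.
  by have := par u u; rewrite subrr /sq normr0 expr0n/=; lra.
have Bclose e y z : B e y -> B e z -> sq (y - z) < e *+ 4.
  move=> [Xy yD] [Xz zD].
  have := par (x - y) (x - z).
  have -> : x - y - (x - z) = - (y - z) by rewrite !opprB addrC addrA subrK.
  have -> : x - y + (x - z) = (x - 2^-1 *: (y + z)) + (x - 2^-1 *: (y + z)).
    rewrite addrACA -opprD [in RHS]addrACA -opprD -scalerDl.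
    have -> : 2^-1 + 2^-1 = 1 :> R[i] by rewrite [RHS]splitr div1r.
    by rewrite scale1r.
  have -> : sq (- (y - z)) = sq (y - z) by rewrite /sq normrN.
  rewrite sq2.
  have := DP _ (XZ 2^-1 _ (XD _ _ Xy Xz)).
  by lra.
have /cauchy_cvg Fcvg : cauchy F.
  apply/cauchyP => eps eps0; pose r : R := complex.Re eps.
  have rE : r%:C = eps by rewrite RRe_real// gtr0_real.
  have r0 : 0 < r by rewrite -ltcR rE.
  have e0 : 0 < r ^+ 2 / 4 by rewrite divr_gt0 ?exprn_gt0.
  have [y By] := B0 _ e0; exists y, (r ^+ 2 / 4) => // z Bz.
  rewrite -ball_normE /= -rE -(ltr_pXn2r (n := 2)) ?nnegrE ?lecR ?(ltW r0)//.
  rewrite -sqE -rmorphXn ltcR (lt_le_trans (Bclose _ _ _ By Bz))//.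
  by lra.
(* Moving z along m by the optimal multiple lowers the squared distance by |(x - z, m)|^2 / |m|^2,
   and at most e is left to gain. *)
have Bortho e z m : B e z -> X m -> `|inner (x - z) m| ^+ 2 <= e%:C * `|m| ^+ 2.
  move=> [Xz zD] Xm; have [->|m0] := eqVneq m 0.
    by rewrite inner0r !normr0 expr0n/= mulr0.
  rewrite -ler_pdivrMr ?exprn_gt0 ?normr_gt0//.
  have := inner_sub_proj (x - z) m0; set t := _ / _.
  rewrite -addrA -opprD => xt.
  have := DP _ (XD _ _ Xz (XZ t _ Xm)); rewrite -lecR sqE xt -sqE => Dz.
  move: zD => /ltW; rewrite -lecR rmorphD/=; move: Dz; rewrite lerBrDr.
  by move=> /le_trans /[apply]; rewrite lerD2l.
exists (lim F).
  apply: Xc => U /Fcvg [e e0 BU].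
  by have [y [Xy yD]] := B0 e e0; exists y; split=> //; exact: BU.
move=> m Xm; set y := lim F.
pose c := complex.Re `|inner (x - y) m|; pose M := complex.Re `|m|.
have cE : c%:C = `|inner (x - y) m| by rewrite RRe_real// ger0_real.
have ME : M%:C = `|m| by exact: norm_real.
have M0 : 0 <= M by rewrite -ler0c ME.
have small d : 0 < d -> c <= 2 * d * M.
  move=> d0; have dd0 : 0 < d ^+ 2 by rewrite exprn_gt0.
  have /Fcvg[e e0 BU] : nbhs y (ball y d%:C) by apply: nbhsx_ballx; rewrite ltcR.
  have me0 : 0 < Num.min e (d ^+ 2) by rewrite lt_min e0 dd0.
  have [z [Xz zD]] := B0 _ me0.
  have yz : `|y - z| < d%:C.
    have : ball y d%:C z.
      by apply: BU; split=> //; apply: lt_le_trans zD _; rewrite lerD2l ge_min lexx.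
    by rewrite -ball_normE.
  have xz : `|inner (x - z) m| <= d%:C * `|m|.
    rewrite -(ler_pXn2r (n := 2)) ?nnegrE ?normr_ge0 ?mulr_ge0 ?ler0c ?(ltW d0)//.
    rewrite exprMn -[d%:C ^+ 2](rmorphXn (real_complex R)).
    apply: Bortho => //; split=> //.
    by apply: lt_le_trans zD _; rewrite lerD2l ge_min lexx orbT.
  rewrite -lecR cE !rmorphM/= ME.
  have -> : x - y = (x - z) - (y - z) by rewrite opprB addrA subrK.
  rewrite innerDl innerNl (le_trans (ler_normB _ _))//.
  have -> : (2 : R)%:C * d%:C * `|m| = d%:C * `|m| + d%:C * `|m|.
    by rewrite -mulrDl -rmorphD/= -rmorphM/=; congr (_%:C * _); lra.
  rewrite lerD// (le_trans (inner_CS _ _))// ler_wpM2r// ltW//.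
apply/eqP; rewrite -normr_eq0 -cE -(rmorph0 (real_complex R)) (inj_eq (@complexI R)).
have c0 : 0 <= c by rewrite -ler0c cE.
rewrite eq_le c0 andbT leNgt; apply/negP => cgt0.
(* This d makes 2dM smaller than c, against [small]. *)
have d0 : 0 < c / (4 * M + 1) by rewrite divr_gt0//; lra.
have := small _ d0; rewrite mulrAC -mulrA.
have : (c / (4 * M + 1)) * (4 * M + 1) = c by rewrite divfK//; apply/eqP; lra.
move: (c / _) d0 => d d0; nra.
Qed.

End Hilbert.

(** * Nest algebras *)

Section NestAlgebra.
Local Open Scope classical_set_scope.
Local Open Scope complex_scope.
Local Open Scope ring_scope.
Variables (R : realType) (H : hilbertType R) (N : nest H).
Implicit Types (x y z u v g h w : H) (k : R[i]) (S T : nest_alg N).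

Definition nest_scalar k : nest_alg N := k *: (1 : nest_alg N).

Lemma nest_scalarE k T : nest_scalar k * T = k *: T.
Proof. by rewrite -nest_alg_scaleAl mul1r. Qed.

Lemma nest_scalarP : scalars nest_scalar.
Proof.
split.
- by move=> a b; rewrite /nest_scalar scalerDl.
- by move=> a b; rewrite nest_scalarE /nest_scalar scalerA.
- exact: scale1r.
- by move=> k T; rewrite nest_scalarE -nest_alg_scaleAr mulr1.
Qed.

Lemma nest_algL T k x y : T (k *: x + y) = k *: T x + T y.
Proof. by have /asboolP[[TL _] _] := nest_algP T; exact: TL. Qed.
Lemma nest_algD T x y : T (x + y) = T x + T y.
Proof. by have := nest_algL T 1 x y; rewrite !scale1r. Qed.
Lemma nest_alg0 T : T 0 = 0.
Proof. by apply: (addrI (T 0)); rewrite -nest_algD !addr0. Qed.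
Lemma nest_algZ T k x : T (k *: x) = k *: T x.
Proof. by have := nest_algL T k x 0; rewrite nest_alg0 !addr0. Qed.
Lemma nest_algB T x y : T (x - y) = T x - T y.
Proof. by rewrite nest_algD -scaleN1r nest_algZ scaleN1r. Qed.

Lemma nest_algE S T : (forall h, S h = T h) -> S = T.
Proof. by move=> ST; apply: val_inj; apply/funext. Qed.

Lemma nest_alg_bound T : exists2 M : R, 0 <= M & forall x, `|T x| <= M%:C * `|x|.
Proof.
have /asboolP[[_ [M TM]] _] := nest_algP T; exists `|M| => // x.
by apply: le_trans (TM x) _; rewrite ler_wpM2r// lecR ler_norm.
Qed.

Lemma nest_alg_stable T X x : nest_set N X -> X x -> X (T x).
Proof.
by have /asboolP[_ TN] := nest_algP T; move=> NX Xx; apply: (TN _ NX); exists x.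
Qed.

Lemma small_eq0 (c M : R) : 0 <= c -> 0 <= M ->
  (forall d, 0 < d -> c <= d * M) -> c = 0.
Proof.
move=> c0 M0 small; apply/eqP; rewrite eq_le c0 andbT leNgt; apply/negP => cgt0.
have d0 : 0 < c / (2 * M + 1) by rewrite divr_gt0//; lra.
have := small _ d0.
have : (c / (2 * M + 1)) * (2 * M + 1) = c by rewrite divfK//; apply/eqP; lra.
move: (c / _) d0 => d d0; nra.
Qed.

Lemma nest_alg_ker_closed T : closed [set h | T h = 0].
Proof.
move=> h hT; have [M M0 TM] := nest_alg_bound T.
pose c := complex.Re `|T h|; have cE : c%:C = `|T h| by exact: norm_real.
suff c0 : c = 0 by apply/eqP; rewrite -normr_eq0 -cE c0.
apply: (small_eq0 (M := M)) => // [|d d0]; first by rewrite -ler0c cE.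
have [|z [Tz]] := hT (ball h d%:C); first by apply: nbhsx_ballx; rewrite ltcR.
rewrite -ball_normE /= => /ltW hz; rewrite -lecR cE rmorphM/= mulrC.
have -> : T h = T (h - z) by rewrite nest_algB Tz subr0.
by rewrite (le_trans (TM _))// ler_wpM2l// ler0c.
Qed.

Definition rank1_in u g := rank1 u g \in nest_operator N.

Lemma rank1P u g : (forall X, nest_set N X -> X u \/ forall h, X h -> inner h g = 0) ->
  rank1_in u g.
Proof.
move=> ug; apply/asboolP; split; first exact: rank1_bounded.
move=> X NX _ [h Xh <-]; have [[X0 XL] _] := nest_subspace NX; rewrite /rank1.
have [Xu|Xg] := ug X NX; last by rewrite Xg// scale0r.
by rewrite -[_ *: _]addr0; exact: XL.
Qed.

Definition rank1_op u g (ug : rank1_in u g) : nest_alg N := NestAlg ug.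

Lemma rank1_opE u g (ug : rank1_in u g) h : rank1_op ug h = inner h g *: u.
Proof. by []. Qed.

Lemma separation X h : linear_subspace X -> closed X -> ~ X h ->
  exists g, inner h g <> 0 /\ forall x, X x -> inner x g = 0.
Proof.
move=> XL Xc Xh; have [y Xy hy] := closed_proj h XL Xc.
exists (h - y); split=> [hg|x Xx]; last by rewrite innerC hy// rmorph0.
apply: Xh; suff -> : h = y by [].
apply/eqP; rewrite -subr_eq0; apply/eqP/inner_eq0.
by rewrite innerDl innerNl hg [inner y _]innerC hy// rmorph0 subr0.
Qed.

Lemma rank1_subspace X u g : nest_set N X -> X u -> (forall x, X x -> inner x g = 0) ->
  rank1_in u g.
Proof.
move=> NX Xu Xg; apply: rank1P => Y NY.
have [XY|YX] := nest_chain NX NY; first by left; exact: XY.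
by right=> h Yh; apply/Xg/YX.
Qed.

(** Compare the factors at h, h0 and h + h0. They agree when F h and F h0 are independent; when F h0
    = t F h, evaluate b at h0 - t h, where F vanishes. *)
Lemma proportional_scalar (b F : H -> H) :
  (forall k x y, b (k *: x + y) = k *: b x + b y) ->
  (forall k x y, F (k *: x + y) = k *: F x + F y) ->
  (forall h, exists k, b h = k *: F h) -> exists k, forall h, b h = k *: F h.
Proof.
move=> bL FL bF.
have [F0|/existsNP[h0 Fh0]] := pselect (forall h, F h = 0).
  by exists 0 => h; have [k ->] := bF h; rewrite F0 !scaler0.
have [k0 bh0] := bF h0; exists k0 => h; have [k bh] := bF h.
have [Fh|Fh] := pselect (F h = 0); first by rewrite bh Fh !scaler0.
have [k1] := bF (1 *: h + h0); rewrite bL FL !scale1r bh bh0 scalerDr => /eqP.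
rewrite -subr_eq0 opprD addrACA -!scalerBl => /eqP k01.
have [kk0|k10] := eqVneq k0 k1.
  move: k01; rewrite kk0 subrr scale0r addr0 => /eqP.
  by rewrite scaler_eq0 subr_eq0 => /orP[/eqP ->|/eqP].
pose t := - ((k0 - k1)^-1 * (k - k1)).
have Fh0t : F h0 = t *: F h.
  apply/eqP; rewrite -subr_eq0 -scaleNr opprK -(scalerA) addrC.
  rewrite -[F h0](scalerK (a := k0 - k1)) ?subr_eq0// -scalerDr k01.
  by rewrite scaler0.
have : b (- t *: h + h0) = 0.
  have [k2 ->] := bF (- t *: h + h0).
  by rewrite FL Fh0t -scalerDl addNr scale0r scaler0.
rewrite bL bh bh0 scalerA mulrC -scalerA scaleNr -Fh0t scalerN addrC => /eqP.
rewrite -scalerBl scaler_eq0 subr_eq0 => /orP[/eqP ->//|/eqP].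
by [].
Qed.

End NestAlgebra.

(** * Peirce axioms from rank-one operators *)

Section Rank1Peirce.
Local Open Scope classical_set_scope.
Local Open Scope complex_scope.
Local Open Scope ring_scope.
Variables (R : realType) (H : hilbertType R) (N : nest H) (E : nest_alg N).
Implicit Types (x y z u v g h w : H) (k : R[i]) (S T : nest_alg N).
Hypothesis EE : E * E = E.
Local Notation F := (1 - E : nest_alg N).
Local Notation K := [set h | E h = h].

Lemma idemE h : E (E h) = E h.
Proof. by rewrite -nest_alg_mulE EE. Qed.

Lemma complE h : F h = h - E h.
Proof. by []. Qed.

Lemma idem_compl h : E (F h) = 0.
Proof. by rewrite complE nest_algB idemE subrr. Qed.

Lemma range_subspace : linear_subspace K /\ closed K.
Proof.
split; first split=> /= [|k x y Ex Ey]; first exact: nest_alg0.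
  by rewrite nest_algL Ex Ey.
have -> : K = [set h | F h = 0]; last exact: nest_alg_ker_closed.
apply/seteqP; split=> h.
  by change (E h = h -> h - E h = 0) => ->; rewrite subrr.
change (h - E h = 0 -> E h = h) => /eqP.
by rewrite subr_eq0 => /eqP.
Qed.

Lemma orth_range g : (forall x, K x -> inner x g = 0) -> forall h, inner (E h) g = 0.
Proof. by move=> Kg h; apply: Kg; exact: idemE. Qed.

Lemma range_separation w : F w = w -> w <> 0 ->
  exists g, inner w g <> 0 /\ forall h, inner (E h) g = 0.
Proof.
move=> Fw w0; have [KL Kc] := range_subspace.
have [|g [wg Kg]] := separation (h := w) KL Kc.
  by move=> /= Ew; apply: w0; rewrite -Ew -Fw idem_compl.
by exists g; split=> //; exact: orth_range.
Qed.

(* Gram-Schmidt applied to the components of w and w' orthogonal to EH. *)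
Lemma range_separation2 w w' : F w = w -> F w' = w' -> (forall k, w' <> k *: w) ->
  exists g, [/\ inner w g = 0, inner w' g <> 0 & forall h, inner (E h) g = 0].
Proof.
move=> Fw Fw' ww'; have [KL Kc] := range_subspace.
have KF0 v : F v = v -> K v -> v = 0 by move=> Fv /= <-; rewrite -Fv idem_compl.
have [w0|w0] := pselect (w = 0).
  have [|g [w'g Eg]] := range_separation Fw'.
    by move=> w'0; apply: (ww' 0); rewrite w'0 scale0r.
  by exists g; split=> //; rewrite w0 inner0l.
have [p Kp wp] := closed_proj w KL Kc; have [p' Kp' wp'] := closed_proj w' KL Kc.
set q := w - p in wp; set q' := w' - p' in wp'.
have q0 : q != 0.
  by apply/eqP => /eqP; rewrite subr_eq0 => /eqP wE; apply/w0/KF0 => //; rewrite wE.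
pose t := inner q' q / `|q| ^+ 2; pose g := q' - t *: q.
have Kg x : K x -> inner x g = 0.
  move=> Kx; rewrite innerDr innerNr innerZr [inner x q]innerC [inner x q']innerC.
  by rewrite wp// wp'// rmorph0 mulr0 subrr.
have qg : inner q g = 0.
  rewrite innerC innerDl innerNl innerZl -inner_norm divfK ?subrr ?rmorph0//.
  by rewrite expf_eq0/= normr_eq0.
have wE : w = p + q by rewrite addrC subrK.
have w'E : w' = p' + (g + t *: q) by rewrite subrK addrC subrK.
exists g; split; last exact: orth_range.
  by rewrite wE innerDl (Kg p Kp) qg addr0.
rewrite w'E innerDl (Kg p' Kp') innerDl innerZl qg mulr0 addr0 add0r.
move=> /inner_eq0 g0; apply: (ww' t); apply/eqP; rewrite -subr_eq0; apply/eqP.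
have w'tw : w' - t *: w = p' - t *: p.
  by rewrite w'E wE g0 add0r (scalerDr t p q) opprD addrACA subrr addr0.
apply: KF0; first by rewrite nest_algB nest_algZ Fw Fw'.
by rewrite w'tw /= nest_algB nest_algZ Kp Kp'.
Qed.

Hypothesis E0 : E <> 0.
Hypothesis E1 : E <> 1.
Hypothesis rank1E : forall u g, E u = u -> (forall h, inner (E h) g = 0) ->
  rank1_in N u g.

Lemma rank1_corner u g (Eu : E u = u) (Eg : forall h, inner (E h) g = 0) :
  corner E F (rank1_op (rank1E Eu Eg)).
Proof.
split; apply: nest_algE => h; rewrite nest_alg_mulE !rank1_opE.
  by rewrite nest_algZ Eu.
by rewrite complE innerDl innerNl Eg subr0.
Qed.

Lemma range_neq0 : exists2 u, E u = u & u <> 0.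
Proof.
have [E0'|/existsNP[h Eh]] := pselect (forall h, E h = 0).
  by case: E0; exact: nest_algE.
by exists (E h) => //; exact: idemE.
Qed.

Lemma kernel_neq0 : exists2 w, F w = w & w <> 0.
Proof.
have [E1'|/existsNP[h Fh]] := pselect (forall h, F h = 0).
  case: E1; apply: nest_algE => h; have := E1' h; rewrite complE => /eqP.
  by rewrite subr_eq0 => /eqP <-.
by exists (F h) => //; rewrite complE idem_compl subr0.
Qed.

(** For the tensor axiom, if b h is not a multiple of F h, choose g vanishing on EH and at F h but
    not at b h; the identity for the operators u (., g), evaluated at F h, makes a scalar on EH. For
    the balanced axiom a fixed vector determines k, and separating functionals force d = kF. *)
Lemma rank1_peirce : peirce (@nest_scalar _ _ N) E F.
Proof.
have cornerEE_scalar c : corner E E c ->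
    (exists k, forall u, E u = u -> c u = k *: u) -> exists k, c = nest_scalar N k * E.
  move=> [Ec cE] [k ck]; exists k; apply: nest_algE => h.
  by rewrite nest_scalarE -cE nest_alg_mulE ck// idemE.
split.
- exact: nest_scalarP.
- exact: EE.
- by rewrite addrC subrK.
- exact: E0.
- by move=> /eqP; rewrite subr_eq0 => /eqP /esym.
- move=> a b c d aE bF cE dF abcd.
  have [bk|/existsNP[h bh]] := pselect (forall h, exists k, b h = k *: F h).
    right; have [|||k bE] := @proportional_scalar _ _ b F.
    + exact: nest_algL.
    + exact: nest_algL.
    + exact: bk.
    + by exists k; apply: nest_algE => h; rewrite nest_scalarE bE.
  left; apply: (cornerEE_scalar) => //.
  have Fw : F (F h) = F h by rewrite complE idem_compl subr0.
  have bw : b (F h) = b h by rewrite -nest_alg_mulE bF.2.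
  have [|||g [wg bwg Eg]] := @range_separation2 (F h) (b h).
  + exact: Fw.
  + by rewrite -nest_alg_mulE bF.1.
  + by move=> k bhk; apply: bh; exists k.
  exists ((inner (b h) g)^-1 * inner (d (F h)) g) => u Eu.
  have abu : a (inner (b (F h)) g *: u) =
      c (inner (F h) g *: u) + inner (d (F h)) g *: u.
    exact: (congr1 (fun T : nest_alg N => T (F h)) (abcd _ (rank1_corner Eu Eg))).
  move: abu; rewrite bw wg scale0r nest_alg0 add0r nest_algZ => abu.
  rewrite -scalerA -abu scalerA mulVf ?scale1r//.
  exact/eqP.
- move=> c d cE dF cd.
  have [w0 Fw0 w0n] := kernel_neq0.
  have [g0 [wg0 Eg0]] := range_separation Fw0 w0n.
  have [|k ck] := cornerEE_scalar _ cE.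
    exists ((inner w0 g0)^-1 * inner (d w0) g0) => u Eu.
    have cu : c (inner w0 g0 *: u) = inner (d w0) g0 *: u.
      exact: (congr1 (fun T : nest_alg N => T w0) (cd _ (rank1_corner Eu Eg0))).
    move: cu; rewrite nest_algZ => cu.
    by rewrite -scalerA -cu scalerA mulVf ?scale1r//; exact/eqP.
  exists k; split=> //; apply: nest_algE => h; rewrite nest_scalarE.
  change (d h = k *: F h).
  apply: contrapT => /eqP; rewrite -subr_eq0 => /eqP dh.
  have [||g [dhg Eg]] := @range_separation (d h - k *: F h).
  + have Fd : F (d h) = d h by exact: (congr1 (fun T : nest_alg N => T h) dF.1).
    by rewrite nest_algB nest_algZ Fd [F (F h)]complE idem_compl subr0.
  + exact: dh.
  apply: dhg; have [u Eu u0] := range_neq0.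
  have := congr1 (fun T : nest_alg N => T (F h)) (cd _ (rank1_corner Eu Eg)).
  rewrite ck nest_scalarE.
  change (k *: E (inner (F h) g *: u) = inner (d (F h)) g *: u ->
    inner (d h - k *: F h) g = 0).
  rewrite nest_algZ Eu -nest_alg_mulE dF.2 scalerA => /eqP.
  rewrite -subr_eq0 -scalerBl scaler_eq0 => /orP[|/eqP//].
  by rewrite subr_eq0 innerDl innerNl innerZl => /eqP ->; rewrite subrr.
Qed.

End Rank1Peirce.

(** * Invariant ranges and intersecting ideals in nest algebras *)

Section NestStructure.
Local Open Scope classical_set_scope.
Local Open Scope complex_scope.
Local Open Scope ring_scope.
Variables (R : realType) (H : hilbertType R) (N : nest H).
Implicit Types (u v g h w : H) (k : R[i]) (S T x y : nest_alg N) (X Y : set H).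

Lemma sub_closed_span (A : set H) : A `<=` closed_span A.
Proof. by move=> h Ah; apply: subset_closure; exact: sub_gen_smallest. Qed.

Lemma closed_span_sub (A X : set H) : linear_subspace X -> closed X ->
  A `<=` X -> closed_span A `<=` X.
Proof.
move=> XL Xc AX; apply: subset_trans Xc; apply: closure_subset.
exact: smallest_sub.
Qed.

(* If k lies in EH but not in the span L of the nest members inside EH, then
   every member contains k or lies in L, so the intersection of the members
   containing k consists of ranges of rank-one elements not killing k. *)
Lemma invariant_range (E : nest_alg N) : E * E = E ->
  (forall T, E * T * E = T * E) -> nest_set N [set h | E h = h].
Proof.
move=> EE ETE; set K := [set h | E h = h].
have [KL Kc] := range_subspace E.
have KT T h : K h -> K (T h).
  move=> Kh; have := congr1 (fun T : nest_alg N => T h) (ETE T).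
  by change (E (T (E h)) = T (E h) -> K (T h)); rewrite Kh.
pose C := [set X | nest_set N X /\ X `<=` K].
pose L := closed_span (\bigcup_(X in C) X).
have NL : nest_set N L by apply: nest_span => X [].
have CL X : C X -> X `<=` L.
  by move=> CX h Xh; apply: sub_closed_span; exists X.
have LK : L `<=` K by apply: closed_span_sub => // h [X [_ XK] /XK].
suff -> : K = L by [].
apply/seteqP; split=> // k Kk; apply: contrapT => Lk.
pose M := \bigcap_(X in [set X | nest_set N X /\ X k]) X.
have NM : nest_set N M by apply: nest_bigcap => X [].
have rk u g : rank1_in N u g -> inner k g <> 0 -> K u.
  move=> ug kg; have := KT (rank1_op ug) k Kk; rewrite rank1_opE => kgu.
  have := KL.2 (inner k g)^-1 _ 0 kgu KL.1.
  by rewrite addr0 scalerA mulVf ?scale1r//; exact/eqP.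
have NXL X : nest_set N X -> X k \/ X `<=` L.
  move=> NX; have [Xk|Xk] := pselect (X k); [by left|right].
  apply: CL; split=> // u Xu; have [XL Xc] := nest_subspace NX.
  have [g [kg Xg]] := separation XL Xc Xk.
  by apply: (rk u g) => //; exact: rank1_subspace NX Xu Xg.
have [LL Lc] := nest_subspace NL.
have [g [kg Lg]] := separation LL Lc Lk.
apply: Lk; apply: (CL M) => [|X []//].
split=> // u Mu; apply: (rk u g) => //; apply: rank1P => X NX.
have [Xk|XL] := NXL X NX; first by left; exact: Mu.
by right=> h Xh; exact/Lg/XL.
Qed.

(** Of a member failing P and a member failing Q, the smaller one would fail both. *)
Lemma chain_alternative (P Q : set H -> Prop) (C : set (set H)) :
  C `<=` nest_set N ->
  (forall X Y, X `<=` Y -> P X -> P Y) -> (forall X Y, X `<=` Y -> Q X -> Q Y) ->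
  (forall X, C X -> P X \/ Q X) ->
  (forall X, C X -> P X) \/ (forall X, C X -> Q X).
Proof.
move=> CN Pup Qup PQ; have [|/existsNP[X /not_implyP[CX PX]]] :=
  pselect (forall X, C X -> P X); [by left|right=> Y CY].
have [//|QX] := PQ X CX.
have [PY|//] := PQ Y CY.
have [XY|YX] := nest_chain (CN _ CX) (CN _ CY); first exact: Qup QX.
by case: PX; exact: Pup PY.
Qed.

Lemma chain_alternative_down (P Q : set H -> Prop) (C : set (set H)) :
  C `<=` nest_set N ->
  (forall X Y, X `<=` Y -> P Y -> P X) -> (forall X Y, X `<=` Y -> Q Y -> Q X) ->
  (forall X, C X -> P X \/ Q X) ->
  (forall X, C X -> P X) \/ (forall X, C X -> Q X).
Proof.
move=> CN Pup Qup PQ; have [|/existsNP[X /not_implyP[CX PX]]] :=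
  pselect (forall X, C X -> P X); [by left|right=> Y CY].
have [//|QX] := PQ X CX.
have [PY|//] := PQ Y CY.
have [XY|YX] := nest_chain (CN _ CX) (CN _ CY); last exact: Qup QX.
by case: PX; exact: Pup PY.
Qed.

Lemma nest_neq0 X : nest_set N X -> X <> [set 0] -> exists2 u, X u & u <> 0.
Proof.
move=> NX X0; apply: contrapT => Xu; apply: X0; apply/seteqP; split=> [u Xu'|_ ->].
  by apply: contrapT => u0; apply: Xu; exists u.
by have [[]] := nest_subspace NX.
Qed.

Lemma nest_neqT X : X <> setT -> exists h, ~ X h.
Proof. by move=> XT; apply/existsNP => Xh; apply: XT; apply/seteqP; split. Qed.

(** Either some nonzero member avoids both vectors, and functionals vanishing on it separate them;
    or h or h' lies in every nonzero member, and is then the range of a rank-one element for any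
    functional. *)
Lemma rank1_common_range h h' : h <> 0 -> h' <> 0 -> exists u g g',
  [/\ u <> 0, inner h g <> 0, inner h' g' <> 0, rank1_in N u g & rank1_in N u g'].
Proof.
move=> h0 h'0; have [[X [NX X0 Xh Xh']]|noX] := pselect
    (exists X, [/\ nest_set N X, X <> [set 0], ~ X h & ~ X h']).
  have [u Xu u0] := nest_neq0 NX X0; have [XL Xc] := nest_subspace NX.
  have [g [hg Xg]] := separation XL Xc Xh.
  have [g' [hg' Xg']] := separation XL Xc Xh'.
  by exists u, g, g'; split=> //; apply: rank1_subspace NX Xu _.
have min v g : (forall X, nest_set N X /\ X <> [set 0] -> X v) -> rank1_in N v g.
  move=> Xv; apply: rank1P => X NX.
  have [->|X0] := pselect (X = [set 0]); first by right=> _ ->; exact: inner0l.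
  by left; exact: Xv.
have hh v : v <> 0 -> inner v v <> 0 by move=> v0 /inner_eq0.
have := @chain_alternative (fun X => X h) (fun X => X h')
  [set X | nest_set N X /\ X <> [set 0]].
case=> [X []//|X Y XY /XY//|X Y XY /XY//|X [NX X0]|Xv|Xv].
- apply: contrapT => /not_orP[Xh Xh']; apply: noX; exists X; split=> //.
- by exists h, h, h'; split=> //; [exact: hh|exact: hh|exact: min|exact: min].
- by exists h', h, h'; split=> //; [exact: hh|exact: hh|exact: min|exact: min].
Qed.

Lemma nest_alg_neq0 x : x <> 0 -> exists h, x h <> 0.
Proof. by move=> x0; apply/existsNP => xh; apply: x0; exact: nest_algE. Qed.

(** Either neither x nor y vanishes on some proper member, and v is taken orthogonal to it; or one
    of them vanishes on all proper members, hence on their closed span. That span is then a proper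
    member, and v orthogonal to it allows every range. *)
Lemma rank1_common_functional x y : x <> 0 -> y <> 0 -> exists w w' v,
  [/\ v <> 0, x w <> 0, y w' <> 0, rank1_in N w v & rank1_in N w' v].
Proof.
move=> x0 y0.
have orth_neq0 X : nest_set N X -> X <> setT ->
    exists2 v, v <> 0 & forall h, X h -> inner h v = 0.
  move=> NX /nest_neqT[h Xh]; have [XL Xc] := nest_subspace NX.
  have [v [hv Xv]] := separation XL Xc Xh; exists v => // v0.
  by apply: hv; rewrite v0 inner0r.
have [w0 xw0] := nest_alg_neq0 x0; have [w0' yw0'] := nest_alg_neq0 y0.
have [[X [NX XT Xx Xy]]|noX] := pselect (exists X, [/\ nest_set N X, X <> setT,
    ~ (forall h, X h -> x h = 0) & ~ (forall h, X h -> y h = 0)]).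
  have [v v0 Xv] := orth_neq0 X NX XT.
  move: Xx Xy => /existsNP[w /not_implyP[Xw xw]] /existsNP[w' /not_implyP[Xw' yw']].
  by exists w, w', v; split=> //; exact: rank1_subspace NX _ Xv.
pose C := [set X | nest_set N X /\ X <> setT].
have fin (z : nest_alg N) : z <> 0 ->
    (forall X, C X -> forall h, X h -> z h = 0) -> exists w w' v,
    [/\ v <> 0, x w <> 0, y w' <> 0, rank1_in N w v & rank1_in N w' v].
  move=> z0 Cz; have NS : nest_set N (closed_span (\bigcup_(X in C) X)).
    by apply: nest_span => X [].
  have [|v v0 Sv] := orth_neq0 _ NS.
    move=> ST; have [h] := nest_alg_neq0 z0; apply.
    have : closed_span (\bigcup_(X in C) X) `<=` [set h | z h = 0].
      apply: closed_span_sub; last by move=> {}h [X CX]; exact: Cz CX h.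
        split=> [|k a b /= za zb]; first exact: nest_alg0.
        by rewrite nest_algL za zb scaler0 addr0.
      exact: nest_alg_ker_closed.
    by rewrite ST; apply.
  have rv w : rank1_in N w v.
    apply: rank1P => X NX; have [->|XT] := pselect (X = setT); first by left.
    by right=> h Xh; apply: Sv; apply: sub_closed_span; exists X.
  by exists w0, w0', v.
have := @chain_alternative_down (fun X => forall h, X h -> x h = 0)
  (fun X => forall h, X h -> y h = 0) C.
case=> [X []//|X Y XY Yx h /XY/Yx//|X Y XY Yx h /XY/Yx//|X [NX XT]|Xx|Xy].
- by apply: contrapT => /not_orP[Xx Xy]; apply: noX; exists X.
- exact: fin x0 Xx.
- exact: fin y0 Xy.
Qed.

Lemma rank1_mul x u g w v (ug : rank1_in N u g) (wv : rank1_in N w v) h :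
  (rank1_op ug * x * rank1_op wv) h = (inner h v * inner (x w) g) *: u.
Proof.
change (inner (x (inner h v *: w)) g *: u = (inner h v * inner (x w) g) *: u).
by rewrite nest_algZ innerZl.
Qed.

(** A rank-one sandwich of x is a multiple of the operator h -> (h, v) u; with u and v common to x
    and y, rescaling makes the two sandwiches equal. *)
Lemma nest_ideals_meet x y : x <> 0 -> y <> 0 ->
  exists r s r' s' : nest_alg N, r * x * s = r' * y * s' /\ r * x * s <> 0.
Proof.
move=> x0 y0; have [w [w' [v [v0 xw yw' wv wv']]]] := rank1_common_functional x0 y0.
have [u [g [g' [u0 wg wg' ug ug']]]] := rank1_common_range xw yw'.
exists (nest_scalar N (inner (x w) g)^-1 * rank1_op ug), (rank1_op wv),
  (nest_scalar N (inner (y w') g')^-1 * rank1_op ug'), (rank1_op wv').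
have xE h : (nest_scalar N (inner (x w) g)^-1 * rank1_op ug * x * rank1_op wv) h =
    inner h v *: u.
  rewrite -!mulrA nest_scalarE nest_alg_scaleE mulrA rank1_mul scalerA mulrC.
  by rewrite mulfK//; exact/eqP.
split.
  apply: nest_algE => h; rewrite xE.
  rewrite -!mulrA nest_scalarE nest_alg_scaleE mulrA rank1_mul scalerA mulrC.
  by rewrite mulfK//; exact/eqP.
move=> /(congr1 (fun T : nest_alg N => T v)); rewrite xE => /eqP.
by rewrite scaler_eq0 => /orP[/eqP/inner_eq0|/eqP].
Qed.

End NestStructure.

Section NestCases.
Local Open Scope classical_set_scope.
Local Open Scope complex_scope.
Local Open Scope ring_scope.
Variables (R : realType) (H : hilbertType R) (N : nest H).
Implicit Types (u v g h w : H) (k : R[i]) (S T x y : nest_alg N) (X Y : set H).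

Lemma nest_projection X : nest_set N X -> exists E : nest_alg N,
  (forall h, X (E h)) /\ (forall h, X h -> E h = h).
Proof.
move=> NX; have [XL Xc] := nest_subspace NX.
have XB u v : X u -> X v -> X (u - v).
  by move=> Xu Xv; rewrite addrC -scaleN1r; exact: XL.2.
have /choice[p pP] h : exists y : H, X y /\ forall m, X m -> inner (h - y) m = 0.
  by have [y Xy hy] := closed_proj h XL Xc; exists y.
have p_uniq h (y : H) : X y -> (forall m, X m -> inner (h - y) m = 0) -> p h = y.
  move=> Xy hy; have [Xp hp] := pP h; apply/eqP; rewrite -subr_eq0; apply/eqP.
  apply: inner_eq0; have Xpy := XB _ _ Xp Xy.
  have -> : inner (p h - y) (p h - y) =
      inner (h - y) (p h - y) - inner (h - p h) (p h - y).
    by rewrite -innerNl -innerDl opprB [in RHS]addrC addrA subrK.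
  by rewrite hp// hy// subrr.
have pid h : X h -> p h = h.
  by move=> Xh; apply: p_uniq => // m _; rewrite subrr inner0l.
have plin k u v : p (k *: u + v) = k *: p u + p v.
  have [Xu hu] := pP u; have [Xv hv] := pP v.
  apply: p_uniq => [|m Xm]; first exact: XL.2.
  by rewrite opprD addrACA -scalerBr innerDl innerZl hu// hv// mulr0 addr0.
have pythagoras (d e : H) : (forall m, X m -> inner d m = 0) -> X e ->
    `|d + e| ^+ 2 = `|e| ^+ 2 + `|d| ^+ 2.
  move=> de Xe; rewrite !inner_norm innerDl !innerDr.
  by rewrite [inner e d]innerC (de e Xe) rmorph0 add0r addr0 addrC.
have pN : p \in nest_operator N.
  apply/asboolP; split.
    split=> //; exists 1 => h; rewrite mul1r.
    have [Xp hp] := pP h.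
    rewrite -(ler_pXn2r (n := 2)) ?nnegrE//.
    have -> : `|h| ^+ 2 = `|p h| ^+ 2 + `|h - p h| ^+ 2.
      by rewrite -(pythagoras _ _ hp Xp) subrK.
    by rewrite lerDl exprn_ge0.
  (* Comparability with X decides: a larger Y contains the range X, and on a smaller Y the
     projection is the identity. *)
  move=> Y NY _ [h Yh <-]; have [XY|YX] := nest_chain NX NY.
    by apply: XY; have [] := pP h.
  by rewrite pid//; exact: YX.
exists (NestAlg pN); split=> [h|h Xh]; first by have [] := pP h.
exact: pid.
Qed.

Lemma idem_peirce (E : nest_alg N) : E * E = E -> E <> 0 -> E <> 1 ->
  (forall T, (1 - E) * T * E = 0) -> peirce (@nest_scalar _ _ N) E (1 - E).
Proof.
move=> EE E0 E1 FTE.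
have ETE T : E * T * E = T * E.
  have := FTE T; rewrite mulrBl mul1r mulrBl => /eqP.
  by rewrite subr_eq0 => /eqP.
apply: rank1_peirce => // u g Eu Eg.
apply: (rank1_subspace (invariant_range EE ETE)) => // h /= <-; exact: Eg.
Qed.

Definition trivial_nest := forall X, nest_set N X -> X = [set 0] \/ X = setT.

Lemma nontrivial_peirce : ~ trivial_nest -> exists E : nest_alg N,
  peirce (@nest_scalar _ _ N) E (1 - E) /\ forall T, (1 - E) * T * E = 0.
Proof.
move=> /existsNP[X /not_implyP[NX /not_orP[X0 XT]]].
have [E [XE EX]] := nest_projection NX.
have FTE T : (1 - E) * T * E = 0.
  apply: nest_algE => h; change (T (E h) - E (T (E h)) = 0).
  by rewrite (EX _ (nest_alg_stable T NX (XE h))) subrr.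
exists E; split=> //; apply: idem_peirce => //.
- by apply: nest_algE => h; exact: EX.
- have [u Xu u0] := nest_neq0 NX X0.
  by move=> E0; apply: u0; rewrite -(EX u Xu) E0.
- have [h Xh] := nest_neqT XT.
  by move=> E1; apply: Xh; have := XE h; rewrite E1.
Qed.

Section Trivial.
Hypothesis Ntriv : trivial_nest.

Lemma trivial_rank1 u g : rank1_in N u g.
Proof.
apply: rank1P => X /Ntriv[->|->]; last by left.
by right=> h ->; exact: inner0l.
Qed.

Lemma trivial_peirce (E : nest_alg N) : E * E = E -> E <> 0 -> E <> 1 ->
  peirce (@nest_scalar _ _ N) E (1 - E).
Proof. by move=> EE E0 E1; apply: rank1_peirce => // u g _ _; exact: trivial_rank1. Qed.

(** Test with y = (., xh) h, for which x y x h = |xh|^2 xh. *)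
Lemma trivial_prime x : (forall y, x * y * x = 0) -> x = 0.
Proof.
move=> xyx; apply: contrapT => /nest_alg_neq0[h xh].
have := congr1 (fun T : nest_alg N => T h) (xyx (rank1_op (trivial_rank1 h (x h)))).
change (x (inner (x h) (x h) *: h) = 0 -> False).
by rewrite nest_algZ => /eqP; rewrite scaler_eq0 => /orP[/eqP/inner_eq0|/eqP].
Qed.

(* Evaluating ad(a)^3 = ad(a) at a rank-one operator whose functional kills h but
   not a h shows that a is quadratic. *)
Lemma trivial_idem a : (forall y, lie a (lie a (lie a y)) = lie a y) ->
  (forall z, (forall x, z * x = x * z) -> exists k, z = nest_scalar N k) ->
  (forall k, a <> nest_scalar N k) ->
  exists e c, e * e = e /\ a = e + nest_scalar N c.
Proof.
move=> a3 centre aS.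
have [ak|/existsNP[h ah]] := pselect (forall h, exists k, a h = k *: h).
  have [|||k ak'] := @proportional_scalar _ _ a id => //; first exact: nest_algL.
  case: (aS k); apply: nest_algE => h; rewrite ak'.
  by [].
(* With idempotent 0 the complement is the identity, so this is plain separation of two independent
   vectors. *)
have [||||g [hg ahg _]] := @range_separation2 _ _ N 0 _ h (a h).
- by rewrite mul0r.
- by change (h - 0 = h); rewrite subr0.
- by change (a h - 0 = a h); rewrite subr0.
- by move=> k ahk; apply: ah; exists k.
pose s := inner (a h) g; pose p := inner (a (a h)) g; pose q := inner (a (a (a h))) g.
have s0 : s != 0 by exact/eqP.
(* For r = (., g) u one has r h = 0, and r sends a h, a^2 h, a^3 h to s u, p u, q u; so only the
   terms of ad(a)^3 r = ad(a) r with an a to the right of r survive at h. *)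
have key u : (s *+ 3) *: a (a u) = (p *+ 3) *: a u + (s - q) *: u.
  set r := rank1_op (trivial_rank1 u g).
  have : a * a * r * a + a * a * r * a + a * a * r * a + r * a * a * a + a * r =
      a * r * a * a + a * r * a * a + a * r * a * a + r * a + a * a * a * r.
    apply/eqP; rewrite -subr_eq0 -oppr_eq0; apply/eqP.
    transitivity (lie a (lie a (lie a r)) - lie a r); last by rewrite a3 subrr.
    by rewrite /lie; nc_ring.
  move=> /(congr1 (fun T : nest_alg N => T h)).
  change (a (a (s *: u)) + a (a (s *: u)) + a (a (s *: u)) + q *: u + a (inner h g *: u) =
    a (p *: u) + a (p *: u) + a (p *: u) + s *: u + a (a (a (inner h g *: u))) -> 
    (s *+ 3) *: a (a u) = (p *+ 3) *: a u + (s - q) *: u).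
  rewrite hg scale0r !nest_alg0 !addr0 !nest_algZ => spq.
  rewrite -!scalerMnl !mulrS !mulr0n !addr0 !addrA scalerBl addrA -spq addrK.
  by [].
have s30 : s *+ 3 != 0 by rewrite mulrn_eq0.
apply: (@quadratic_idem _ _ (@nest_scalar _ _ N) a ((s *+ 3)^-1 * (p *+ 3))
  ((s *+ 3)^-1 * (s - q))) => //; first exact: nest_scalarP.
apply: nest_algE => u; rewrite nest_alg_addE nest_scalarE !nest_alg_scaleE.
by rewrite -!scalerA -scalerDr -key scalerA mulVf ?scale1r.
Qed.

(** P is the orthogonal projection onto the line of p0, and q0 ensures P <> 1. If v does not kill p0
    it is injective on that line, which contains the range of u. *)
Lemma trivial_minimal (p0 q0 : H) : p0 <> 0 -> (forall k, q0 <> k *: p0) ->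
  exists P : nest_alg N, [/\ peirce (@nest_scalar _ _ N) P (1 - P),
    peirce (@nest_scalar _ _ N) (1 - P) P &
    forall u v : nest_alg N, corner P (1 - P) u -> corner (1 - P) P v ->
      v * u = 0 -> u = 0 \/ v = 0].
Proof.
move=> p00 q0p.
have pp0 : inner p0 p0 != 0 by apply/eqP => /inner_eq0.
pose P := nest_scalar N (inner p0 p0)^-1 * rank1_op (trivial_rank1 p0 p0).
have PE h : P h = ((inner p0 p0)^-1 * inner h p0) *: p0.
  by rewrite /P nest_scalarE nest_alg_scaleE rank1_opE scalerA.
have Pp : P p0 = p0 by rewrite PE mulVf// scale1r.
have PP : P * P = P.
  by apply: nest_algE => h; rewrite nest_alg_mulE [in RHS]PE [P h]PE nest_algZ Pp.
have P0 : P <> 0 by move=> P0; apply: p00; rewrite -Pp P0.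
have P1 : P <> 1.
  move=> P1; apply: (q0p ((inner p0 p0)^-1 * inner q0 p0)).
  by rewrite -PE P1.
have QQ : (1 - P) * (1 - P) = 1 - P.
  by rewrite mulrBr mulr1 mulrBl mul1r PP subrr subr0.
have Q0 : 1 - P <> 0 by move=> /eqP; rewrite subr_eq0 => /eqP /esym.
have Q1 : 1 - P <> 1.
  by move=> Q1; apply: P0; rewrite -[P]opprK -[- P](addKr 1) Q1 addNr oppr0.
exists P; split; first exact: trivial_peirce.
  by have := trivial_peirce QQ Q0 Q1; rewrite opprB addrCA subrr addr0.
move=> u v [Pu uQ] [Qv vP] vu.
have [vp|vp] := pselect (v p0 = 0).
  right; apply: nest_algE => h; rewrite -vP nest_alg_mulE PE nest_algZ vp.
  by rewrite scaler0.
left; apply: nest_algE => h.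
have := congr1 (fun T : nest_alg N => T h) vu; rewrite -Pu.
change (v (P (u h)) = 0 -> P (u h) = 0).
rewrite PE nest_algZ => /eqP; rewrite scaler_eq0 => /orP[/eqP ->|/eqP//].
by rewrite scale0r.
Qed.

End Trivial.
End NestCases.

(** * Lie triple isomorphisms between nest algebras *)

Section LieTripleNest.
Variables (R : realType) (H : hilbertType R).

Lemma nontrivial_dim2 (N : nest H) : ~ trivial_nest N ->
  exists p q : H, p <> 0 /\ forall k, q <> k *: p.
Proof.
move=> /existsNP[X /not_implyP[NX /not_orP[X0 XT]]].
have [p Xp p0] := nest_neq0 NX X0; have [q Xq] := nest_neqT XT.
exists p, q; split=> // k qE; apply: Xq; rewrite qE -[_ *: _]addr0.
by have [[X00 XL] _] := nest_subspace NX; exact: XL.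
Qed.

Section Equiv.
Variables (N N' : nest H).
Variables (l : nest_alg N -> nest_alg N') (l' : nest_alg N' -> nest_alg N).
Hypothesis lP : lie_triple_equiv (@nest_scalar _ _ N) (@nest_scalar _ _ N') l l'.

Lemma pos_or_neg_nest (G P : nest_alg _)
  (GHP : peirce (@nest_scalar _ _ N) G (1 - G))
  (PQP : peirce (@nest_scalar _ _ N') P (1 - P))
  (QP0 : forall y, (1 - P) * y * P = 0) :
  (forall x, lie (l' P) x = x -> x = 0) \/ (forall x, lie (l' P) x = - x -> x = 0).
Proof. exact: (pos_or_neg lP GHP PQP QP0 (@nest_ideals_meet _ _ N)). Qed.

End Equiv.

(** The inverse of -l takes P to [l' (- P)]; the sign reduces the case without eigenvalue 1 to the
    case without eigenvalue -1. *)
Lemma neg_equiv (N N' : nest H) (l : nest_alg N -> nest_alg N')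
    (l' : nest_alg N' -> nest_alg N) (P : nest_alg N') :
  lie_triple_equiv (@nest_scalar _ _ N) (@nest_scalar _ _ N') l l' ->
  (forall x, lie (l' P) x = x -> x = 0) ->
  forall x, lie (l' (- P)) x = - x -> x = 0.
Proof.
move=> lP a0 x.
have -> : l' (- P) = - l' P.
  exact: (ltripleN (@nest_scalarP _ _ N') (@nest_scalarP _ _ N) (ltriple_inv lP)).
by rewrite lieNl => /oppr_inj; exact: a0.
Qed.

(** If [N] were trivial, ad(a) or -ad(a) would be idempotent on a prime algebra, so a would be a
    scalar, which the preimage of P is not. *)
Lemma nontrivial_source (N N' : nest H) (l : nest_alg N -> nest_alg N')
    (l' : nest_alg N' -> nest_alg N) :
  lie_triple_equiv (@nest_scalar _ _ N) (@nest_scalar _ _ N') l l' ->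
  ~ trivial_nest N' -> ~ trivial_nest N.
Proof.
move=> lP N'n Nt; have [p [q [p0 qp]]] := nontrivial_dim2 N'n.
have [G [GHP _ _]] := trivial_minimal Nt p0 qp.
have [P [PQP QP0]] := nontrivial_peirce N'n.
have [a0|a0] := pos_or_neg_nest lP GHP PQP QP0.
  apply: (not_prime_pos (ltripleNeg lP) GHP PQP); first exact: neg_equiv lP a0.
  exact: trivial_prime.
apply: (not_prime_pos lP GHP PQP a0); exact: trivial_prime.
Qed.

Lemma nontrivial_standard (N N' : nest H) (l : nest_alg N -> nest_alg N')
    (l' : nest_alg N' -> nest_alg N) :
  lie_triple_equiv (@nest_scalar _ _ N) (@nest_scalar _ _ N') l l' ->
  ~ trivial_nest N -> ~ trivial_nest N' ->
  lie_standard (@nest_scalar _ _ N) (@nest_scalar _ _ N') l.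
Proof.
move=> lP Nn N'n.
have [G [GHP HG0]] := nontrivial_peirce Nn.
have [P [PQP QP0]] := nontrivial_peirce N'n.
have [a0|a0] := pos_or_neg_nest lP GHP PQP QP0.
  apply: (lie_standard_neg (@nest_scalarP _ _ N')).
  apply: (lie_standard_pos (ltripleNeg lP) GHP PQP QP0 HG0) => [E|].
    exact: idem_peirce.
  exact: neg_equiv lP a0.
by apply: (lie_standard_pos lP GHP PQP QP0 HG0) => // E; exact: idem_peirce.
Qed.

Lemma trivial_standard (N N' : nest H) (l : nest_alg N -> nest_alg N')
    (l' : nest_alg N' -> nest_alg N) (p q : H) :
  lie_triple_equiv (@nest_scalar _ _ N) (@nest_scalar _ _ N') l l' ->
  trivial_nest N -> trivial_nest N' -> p <> 0 -> (forall k, q <> k *: p) ->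
  lie_standard (@nest_scalar _ _ N) (@nest_scalar _ _ N') l.
Proof.
move=> lP Nt N't p0 qp.
have [G [GHP _ _]] := trivial_minimal Nt p0 qp.
have [P [PQP QPP minP]] := trivial_minimal N't p0 qp.
have aS := preimage_not_scalar lP GHP PQP.
have [e [c [ee aE]]] := trivial_idem Nt (ad3 lP GHP PQP) (centre_scalar GHP) aS.
have eP : peirce (@nest_scalar _ _ N) e (1 - e).
  apply: trivial_peirce => // e1.
    by apply: (aS c); rewrite aE e1 add0r.
  by apply: (aS (1 + c)); rewrite aE e1 scalarD ?scalar1//; exact: nest_scalarP.
exact: (pl_minimal lP eP PQP QPP aE minP).
Qed.

(** All operators are scalars, so m can keep the scalar and n takes up the rest. As H = 0 is
    included, that scalar need not be unique; identities are therefore checked on vectors. *)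
Lemma scalar_standard (N N' : nest H) (l : nest_alg N -> nest_alg N') :
  (forall p q : H, p <> 0 -> exists k, q = k *: p) ->
  lie_standard (@nest_scalar _ _ N) (@nest_scalar _ _ N') l.
Proof.
move=> dim1.
have scal (M : nest H) (T : nest_alg M) : exists k, T = nest_scalar M k.
  have [|||k Tk] := @proportional_scalar _ _ T id => //; first exact: nest_algL.
    move=> h; have [->|h0] := pselect (h = 0); last exact: dim1.
    by exists 0; rewrite nest_alg0 scaler0.
  by exists k; exact: nest_algE.
have /choice[f fP] := scal N; have /choice[f' f'P] := scal N'.
pose m (T : nest_alg N) : nest_alg N' := nest_scalar N' (f T).
pose m' (T : nest_alg N') : nest_alg N := nest_scalar N (f' T).
have mE T h : m T h = T h by rewrite [in RHS](fP T).
have m'E T h : m' T h = T h by rewrite [in RHS](f'P T).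
exists m, (fun T => f' (l T - m T)); split.
- move=> k S T; apply: nest_algE => h; rewrite mE.
  by change (k *: S h + T h = k *: m S h + m T h); rewrite !mE.
- by exists m' => T; apply: nest_algE => h; rewrite ?(mE, m'E).
- left=> S T; apply: nest_algE => h; rewrite mE.
  by change (S (T h) = m S (m T h)); rewrite !mE.
- by left => T; rewrite -f'P addrC subrK.
Qed.

Lemma lie_triple_standard (N N' : nest H) (l : nest_alg N -> nest_alg N') :
  lie_triple_isomorphism l ->
  lie_standard (@nest_scalar _ _ N) (@nest_scalar _ _ N') l.
Proof.
move=> [lL [l' lK l'K] l_lie].
have lP : lie_triple_equiv (@nest_scalar _ _ N) (@nest_scalar _ _ N') l l'.
  by split=> // k x y; rewrite !nest_scalarE lL.
have [[p [q [p0 qp]]]|dim1] :=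
  pselect (exists p q : H, p <> 0 /\ forall k, q <> k *: p); last first.
  apply: scalar_standard => p q p0; apply: contrapT => qp; apply: dim1.
  by exists p, q; split=> // k qk; apply: qp; exists k.
have [N't|N'n] := pselect (trivial_nest N').
  have [Nt|Nn] := pselect (trivial_nest N); first exact: trivial_standard lP Nt N't p0 qp.
  by case: (nontrivial_source (ltriple_inv lP) Nn N't).
exact: nontrivial_standard lP (nontrivial_source lP N'n) N'n.
Qed.

End LieTripleNest.

(** An anti-morphism changes the sign of a commutator, and this happens twice. *)
Lemma morph_lie2 (A A' : pzRingType) (m : A -> A') (x y z : A) :
  {morph m : u v / u - v} ->
  (forall u v, m (u * v) = m u * m v) \/ (forall u v, m (u * v) = m v * m u) ->
  m (lie (lie x y) z) = lie (lie (m x) (m y)) (m z).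
Proof.
by move=> mB [] mM; rewrite /lie !(mB, mM); nc_ring.
Qed.

Theorem corollary4p6 (R : realType) (H : hilbertType R) (N N' : nest H)
    (l : nest_alg N -> nest_alg N') (hl : lie_triple_isomorphism l) :
  exists m n : nest_alg N -> nest_alg N',
    [/\ alg_isomorphism m \/ alg_antiisomorphism m,
        linear n,
        forall x, exists c : R[i], n x = c *: (1 : nest_alg N'),
        forall x y z, n (lie (lie x y) z) = 0 &
        (forall x, l x = m x + n x) \/ (forall x, l x = - m x + n x)].
Proof.
have [lL _ l_lie] := hl.
have [m [n [mL mB mM lmn]]] := lie_triple_standard hl.
have mlin : linear m by move=> k x y; have := mL k x y; rewrite !nest_scalarE.
have mD x y : m (x - y) = m x - m y by rewrite -[- y]scaleN1r addrC mlin scaleN1r addrC.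
exists m, (fun x => nest_scalar N' (n x)); split.
- by case: mM => mM; [left|right].
- move=> k x y; case: lmn => lmn.
    have nE u : nest_scalar N' (n u) = l u - m u by rewrite lmn addrC addKr.
    by rewrite !nE lL mlin scalerBr opprD addrACA.
  have nE u : nest_scalar N' (n u) = l u + m u by rewrite lmn addrC addNKr.
  by rewrite !nE lL mlin scalerDr addrACA.
- by move=> x; exists (n x).
(* Scalars drop out of commutators, so l and its part m or -m agree on the right-hand side; -m also
   preserves second commutators, as three signs make one. *)
- move=> x y z; have nP := @nest_scalarP _ _ N'.
  have sl u v c : lie (u + nest_scalar N' c) v = lie u v.
    by rewrite lieDl lie_scalar// addr0.
  have sr u v c : lie u (v + nest_scalar N' c) = lie u v.
    by rewrite lieD lie_scalar_r// addr0.
  have := l_lie x y z; case: lmn => lmn; rewrite !lmn !(sl, sr).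
    by rewrite -(morph_lie2 x y z mD mM) => /eqP; rewrite -subr_eq0 addrC addKr => /eqP.
  rewrite !(lieNl, lieN) !opprK -(morph_lie2 x y z mD mM) => /eqP.
  by rewrite -subr_eq0 addrC addKr => /eqP.
- exact: lmn.
Qed.
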